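(* Let $V(x,y,z)$ be the first coordinate of the octahedral superflow $\phi_{\mathbb{O}}(x,y,z)=(V(x,y,z),V(y,z,x),V(z,x,y))$. Let $x,y,z\ge 0$ be real, not all zero, with $y\ge z$, satisfying $$\frac{(x^2+y^2+z^2)^2}{x^4+y^4+z^4}=\frac95,\qquad x^2\ge\frac23(x^2+y^2+z^2).$$ Let $$T(x,y,z)=\frac14\Bigg[\frac{\sqrt{L(x,y,z)}+\wp'(\sqrt{x^2+y^2+z^2})}{K(x,y,z)-\wp(\sqrt{x^2+y^2+z^2})}\Bigg]^2-K(x,y,z)-\wp(\sqrt{x^2+y^2+z^2}),$$ where $K$ and $L$ are the $0$-homogeneous rational functions $$K(x,y,z)=-\frac{3x^2(2x^2-y^2-z^2)(x^2-2y^2-2z^2)}{(x^2+y^2+z^2)^3},$$ $$L(x,y,z)=\frac{x^2(2x^2-y^2-z^2)(x^2-2y^2-2z^2)}{9(x^2+y^2+z^2)^9}\Big((y^2+z^2+10x^2)^2-108x^4\Big)\Big((2y^2+2z^2-7x^2)^2-27x^4\Big)^2,$$ the value $\sqrt{L(x,y,z)}$ is assumed non-negative, and $\wp$ is the Weierstrass elliptic function satisfying $\wp'^2=4\wp^3-\frac{16}{27}\wp$. Define $$J(x,y,z)=-108\,T+12i\sqrt{12-81T^2}.$$ Then $J(x,y,z)\in\mathbb{C}$, $|J(x,y,z)|=24\sqrt3$, and $$V(x,y,z)=\Big(\frac{J(x,y,z)^{1/3}}{18}+\frac{2}{3J(x,y,z)^{1/3}}+\frac13\Big)^{1/2}\cdot\sqrt{x^2+y^2+z^2}\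 \in\mathbb{R}_{+},$$ where the cube root is chosen with $|\arg(J^{1/3})|\le\frac{\pi}{3}$.
   Context: A projective flow is a map $\phi$ such that $\phi^{t}(\mathbf{x})=t^{-1}\phi(\mathbf{x}t)$ satisfies $\phi^{t+s}=\phi^t\circ\phi^s$ and $\lim_{t\to0}\phi^t(\mathbf{x})=\mathbf{x}$; its vector field is $\frac{d}{dt}\phi^t(\mathbf{x})|_{t=0}$, so $\phi^t$ is the time-$t$ map of the vector field and $\phi=\phi^1$. The octahedral superflow $\phi_{\mathbb{O}}$ is the projective flow with vector field $$\Big(\frac{y^3z-yz^3}{x^2+y^2+z^2},\ \frac{z^3x-zx^3}{x^2+y^2+z^2},\ \frac{x^3y-xy^3}{x^2+y^2+z^2}\Big).$$ The function $\wp$ has a double pole at $0$ (standard Weierstrass function with $g_2=\frac{16}{27}$, $g_3=0$). Square roots of non-negative reals are non-negative; at poles of $\wp$ the formula for $T$ is understood by continuity. *)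

(* Defs.v *)
From Stdlib Require Import Reals ZArith.
From Coquelicot Require Import Coquelicot.
Open Scope R_scope.

(* ** Projective flows on R^3 *)

(* phi^t(p) = t^{-1} phi(p t); the value at t = 0 is the prescribed limit p. *)
Definition time_map (phi : R * R * R -> R * R * R) (t : R) (p : R * R * R)
  : R * R * R :=
  if Req_EM_T t 0 then p else scal (/ t) (phi (scal t p)).

Definition is_projective_flow (phi : R * R * R -> R * R * R) : Prop :=
  (forall (s t : R) (p : R * R * R),
     time_map phi (t + s) p = time_map phi t (time_map phi s p)) /\
  (forall p : R * R * R,
     filterlim (fun t => time_map phi t p) (locally' 0) (locally p)).

Definition has_vector_field (phi X : R * R * R -> R * R * R) : Prop :=
  forall p : R * R * R, is_derive (fun t => time_map phi t p) 0 (X p).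

(* At the origin the total division gives 0, the continuous extension. *)
Definition octahedral_field (p : R * R * R) : R * R * R :=
  let '(x, y, z) := p in
  ((y ^ 3 * z - y * z ^ 3) / (x ^ 2 + y ^ 2 + z ^ 2),
   (z ^ 3 * x - z * x ^ 3) / (x ^ 2 + y ^ 2 + z ^ 2),
   (x ^ 3 * y - x * y ^ 3) / (x ^ 2 + y ^ 2 + z ^ 2)).

Definition is_octahedral_superflow (phi : R * R * R -> R * R * R) : Prop :=
  is_projective_flow phi /\ has_vector_field phi octahedral_field.

(* ** The Weierstrass function of the lattice Z w1 + Z w2 *)

Definition lattice_pt (w1 w2 : C) (m n : Z) : C :=
  (RtoC (IZR m) * w1 + RtoC (IZR n) * w2)%C.

Definition in_lattice (w1 w2 z : C) : Prop :=
  exists m n : Z, z = lattice_pt w1 w2 m n.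

(* w1 and w2 are linearly independent over R. *)
Definition is_lattice_basis (w1 w2 : C) : Prop := Im (w1 * Cconj w2)%C <> 0.

Definition wp_term (w1 w2 z : C) (m n : Z) : C :=
  if (Z.eqb m 0 && Z.eqb n 0)%bool then RtoC 0
  else (1 / (z - lattice_pt w1 w2 m n) ^ 2 - 1 / (lattice_pt w1 w2 m n) ^ 2)%C.

(* 1/z^2 + sum of wp_term over the square |m|, |n| <= N. *)
Definition wp_partial (w1 w2 z : C) (N : nat) : C :=
  (1 / z ^ 2 +
   sum_n (fun i : nat =>
     sum_n (fun j : nat =>
       wp_term w1 w2 z (Z.of_nat i - Z.of_nat N) (Z.of_nat j - Z.of_nat N))
       (2 * N)) (2 * N))%C.

(* For z outside the lattice the double series converges absolutely, so the
   exhaustion by squares is immaterial; lattice points, the poles, get junk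
   values. *)
Definition wp (w1 w2 z : C) : C :=
  (real (Lim_seq (fun N => Re (wp_partial w1 w2 z N))),
   real (Lim_seq (fun N => Im (wp_partial w1 w2 z N)))).

Definition wp' (w1 w2 : C) : C -> C := C_derive (wp w1 w2).

(* wp is the Weierstrass function with invariants g2 and g3. *)
Definition wp_satisfies_ode (w1 w2 g2 g3 : C) : Prop :=
  forall z : C, ~ in_lattice w1 w2 z ->
    (wp' w1 w2 z ^ 2 = 4 * wp w1 w2 z ^ 3 - g2 * wp w1 w2 z - g3)%C.

(* ** The ingredients of the formula *)

Definition rad (x y z : R) : R := sqrt (x ^ 2 + y ^ 2 + z ^ 2).

Definition admissible (x y z : R) : Prop :=
  0 <= x /\ 0 <= y /\ 0 <= z /\ ~ (x = 0 /\ y = 0 /\ z = 0) /\ z <= y /\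
  (x ^ 2 + y ^ 2 + z ^ 2) ^ 2 / (x ^ 4 + y ^ 4 + z ^ 4) = 9 / 5 /\
  x ^ 2 >= 2 / 3 * (x ^ 2 + y ^ 2 + z ^ 2).

Definition octK (x y z : R) : R :=
  - (3 * x ^ 2 * (2 * x ^ 2 - y ^ 2 - z ^ 2) * (x ^ 2 - 2 * y ^ 2 - 2 * z ^ 2)
     / (x ^ 2 + y ^ 2 + z ^ 2) ^ 3).

Definition octL (x y z : R) : R :=
  x ^ 2 * (2 * x ^ 2 - y ^ 2 - z ^ 2) * (x ^ 2 - 2 * y ^ 2 - 2 * z ^ 2)
    / (9 * (x ^ 2 + y ^ 2 + z ^ 2) ^ 9)
  * ((y ^ 2 + z ^ 2 + 10 * x ^ 2) ^ 2 - 108 * x ^ 4)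
  * ((2 * y ^ 2 + 2 * z ^ 2 - 7 * x ^ 2) ^ 2 - 27 * x ^ 4) ^ 2.

Definition octT_formula (w1 w2 : C) (x y z : R) : C :=
  let K := RtoC (octK x y z) in
  let P := wp w1 w2 (RtoC (rad x y z)) in
  let P' := wp' w1 w2 (RtoC (rad x y z)) in
  (1 / 4 * ((RtoC (sqrt (octL x y z)) + P') / (K - P)) ^ 2 - K - P)%C.

(* T is the value of T(x,y,z): the formula (well defined) when rad x y z is not
   a pole of wp, and its limit along non-polar admissible points otherwise. *)
Definition is_octT (w1 w2 : C) (x y z : R) (T : C) : Prop :=
  (~ in_lattice w1 w2 (RtoC (rad x y z)) ->
     RtoC (octK x y z) <> wp w1 w2 (RtoC (rad x y z)) /\
     T = octT_formula w1 w2 x y z) /\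
  (in_lattice w1 w2 (RtoC (rad x y z)) ->
     filterlim (fun p : R * R * R =>
                  let '(x', y', z') := p in octT_formula w1 w2 x' y' z')
       (within (fun p : R * R * R =>
                  let '(x', y', z') := p in
                  admissible x' y' z' /\
                  ~ in_lattice w1 w2 (RtoC (rad x' y' z')))
               (locally (x, y, z)))
       (locally T)).

Definition octJ (T : R) : C :=
  (RtoC (- 108 * T) + 12 * Ci * RtoC (sqrt (12 - 81 * T ^ 2)))%C.

(* c is a cube root of w with |arg c| <= PI / 3. *)
Definition is_cube_root (w c : C) : Prop :=
  (c ^ 3)%C = w /\
  exists theta : R, Rabs theta <= PI / 3 /\
    c = (RtoC (Cmod c) * (RtoC (cos theta) + Ci * RtoC (sin theta)))%C.

(* Main.v *)
Require Import Defs.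
From Stdlib Require Import Reals ZArith Lra Lia Psatz.
From Coquelicot Require Import Coquelicot.
Open Scope R_scope.

(** The flow preserves [x^2 + y^2 + z^2], and by homogeneity everything reduces to
    orbits on the unit sphere run for time [r = sqrt (x^2 + y^2 + z^2)].  There the
    quartic [x^4 + y^4 + z^4] is a second first integral, with value 5/9 under the
    hypotheses, so the squares [a, b, c] of the coordinates are the roots of
    [a (a - 1/3) (a - 2/3) = p], where only [p = (x y z)^2] varies in time
    ([other_roots_product]).  The product [m = (27/2) x y z] satisfies
    [m'^2 + (4/27) m^4 = 1]: its derivative is a multiple of the Vandermonde product
    of the roots, whose square is the discriminant of the cubic
    ([orbit_lemniscatic]).  The choice of 5/9 makes this a lemniscate equation.

    Hence [T = -27 p = -(4/27) m^2] evolves like the Weierstrass function.  Let [S] be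
    the solution of the same equation with [S 0 = 0] and [S' 0 = 1]; it exists because
    one orbit of the flow provides it ([lemniscate_sine_exists]).  Then
    [wp t = 1 / S t ^ 2] on the real line ([wp_lemniscate]), and Euler's addition
    theorem ([lemniscatic_addition]) gives [m r] from [m 0], [m' 0], [S r] and [S' r].
    Rewriting it in terms of [wp r = 1 / S^2], [wp' r = - 2 S' / S^3],
    [K = -(4/27) (m 0)^2] and [sqrt L = (8/27) m 0 * m' 0] turns it into the formula for
    [T] ([weierstrass_addition]).  Unlike the formula with [wp], Euler's has a
    denominator that never vanishes, and this settles the value of [T] at the poles.

    The identity [wp = 1 / S^2] has to come out of the series that defines [wp].
    Near a real point [t0] the series is a possible pole [1 / (t - t0)^2] plus a twice
    differentiable function of real [t] ([wp_local]), so [u = 1 / wp] is twice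
    differentiable, through the poles as well, and the equation of [wp] becomes
    [u'^2 = 4 u - (16/27) u^3].  This first-order equation alone does not determine [u]
    where [u' = 0]; differentiating it gives [u'' = 2 - (8/9) u^2] wherever [u' <> 0],
    and since the first two derivatives of [S^2] never vanish together this is enough
    to continue the equality [u = S^2] past every point ([local_uniqueness],
    [real_induction]).  In particular [wp] turns out to be real on the real
    line.

    Finally the cube root formula is Cardano's: [T] determines [a = x^2] as a root of
    the cubic, the bound on the argument selects the largest root, and the orbit stays
    on the branch [a >= 2/3] because [p >= 0] excludes the values of [a] between 1/3
    and 2/3 ([orbit_largest_coordinate]). *)

(** * Curves in the complex plane with a real parameter *)

Definition derivable_C (f : R -> C) (t : R) (l : C) : Prop :=
  is_derive (fun s => Re (f s)) t (Re l) /\ is_derive (fun s => Im (f s)) t (Im l).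

Lemma derivable_C_ext_loc (f g : R -> C) (t : R) (l : C) :
  locally t (fun s => f s = g s) -> derivable_C f t l -> derivable_C g t l.
Proof.
  intros He [H1 H2].
  split; (eapply is_derive_ext_loc; [|eassumption]);
    revert He; apply filter_imp; intros s ->; easy.
Qed.

Lemma derivable_C_unique (f : R -> C) (t : R) (l l' : C) :
  derivable_C f t l -> derivable_C f t l' -> l = l'.
Proof.
  intros [H1 H2] [H3 H4].
  apply is_derive_unique in H1, H2, H3, H4.
  apply injective_projections; unfold Re, Im in *; congruence.
Qed.

Lemma derivable_C_RtoC (f : R -> R) (t l : R) :
  is_derive f t l -> derivable_C (fun s => RtoC (f s)) t (RtoC l).
Proof.
  intro H. split; [exact H|]. simpl.
  apply (is_derive_const (K := R_AbsRing) (V := R_NormedModule)).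
Qed.

Lemma derivable_C_const (c : C) (t : R) : derivable_C (fun _ => c) t 0.
Proof.
  split; apply (is_derive_const (K := R_AbsRing) (V := R_NormedModule)).
Qed.

Lemma derivable_C_plus (f g : R -> C) (t : R) (l m : C) :
  derivable_C f t l -> derivable_C g t m ->
  derivable_C (fun s => (f s + g s)%C) t (l + m)%C.
Proof.
  intros [H1 H2] [H3 H4].
  split; apply (is_derive_plus (K := R_AbsRing) (V := R_NormedModule)); easy.
Qed.

Lemma derivable_C_opp (f : R -> C) (t : R) (l : C) :
  derivable_C f t l -> derivable_C (fun s => (- f s)%C) t (- l)%C.
Proof.
  intros [H1 H2].
  split; apply (is_derive_opp (K := R_AbsRing) (V := R_NormedModule)); easy.
Qed.

Lemma derivable_C_minus (f g : R -> C) (t : R) (l m : C) :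
  derivable_C f t l -> derivable_C g t m ->
  derivable_C (fun s => (f s - g s)%C) t (l - m)%C.
Proof. intros. apply derivable_C_plus; [|apply derivable_C_opp]; easy. Qed.

Lemma is_derive_Rmult (f g : R -> R) (t l m : R) :
  is_derive f t l -> is_derive g t m ->
  is_derive (fun s => f s * g s) t (l * g t + f t * m).
Proof. intros. apply (is_derive_mult f g t l m); auto. intros; apply Rmult_comm. Qed.

Lemma is_derive_Rplus (f g : R -> R) (t l m : R) :
  is_derive f t l -> is_derive g t m ->
  is_derive (fun s => f s + g s) t (l + m).
Proof. apply (is_derive_plus (K := R_AbsRing) (V := R_NormedModule)). Qed.

Lemma is_derive_Rminus (f g : R -> R) (t l m : R) :
  is_derive f t l -> is_derive g t m ->
  is_derive (fun s => f s - g s) t (l - m).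
Proof. apply (is_derive_minus (K := R_AbsRing) (V := R_NormedModule)). Qed.

Lemma derivable_C_mult (f g : R -> C) (t : R) (l m : C) :
  derivable_C f t l -> derivable_C g t m ->
  derivable_C (fun s => (f s * g s)%C) t (l * g t + f t * m)%C.
Proof.
  intros [H1 H2] [H3 H4]. split.
  - apply (is_derive_ext (fun s => Re (f s) * Re (g s) - Im (f s) * Im (g s)));
      [easy|].
    replace (Re (l * g t + f t * m)%C)
      with ((Re l * Re (g t) + Re (f t) * Re m) - (Im l * Im (g t) + Im (f t) * Im m))
      by (rewrite re_plus, !re_mult; ring).
    apply (is_derive_minus (K := R_AbsRing) (V := R_NormedModule));
      now apply is_derive_Rmult.
  - apply (is_derive_ext (fun s => Re (f s) * Im (g s) + Im (f s) * Re (g s)));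
      [easy|].
    replace (Im (l * g t + f t * m)%C)
      with ((Re l * Im (g t) + Re (f t) * Im m) + (Im l * Re (g t) + Im (f t) * Re m))
      by (rewrite im_plus, !im_mult; ring).
    apply (is_derive_plus (K := R_AbsRing) (V := R_NormedModule));
      now apply is_derive_Rmult.
Qed.

Lemma sum_sqr_nonzero (z : C) : z <> 0 -> fst z ^ 2 + snd z ^ 2 <> 0.
Proof.
  intros Hz E. apply Hz. apply injective_projections; simpl; nra.
Qed.

Lemma derivable_C_inv (f : R -> C) (t : R) (l : C) :
  f t <> 0 -> derivable_C f t l ->
  derivable_C (fun s => (/ f s)%C) t (- (l * (/ f t) ^ 2))%C.
Proof.
  intros Hf [H1 H2]. assert (HN := sum_sqr_nonzero _ Hf).
  set (N := fun s => Re (f s) ^ 2 + Im (f s) ^ 2).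
  assert (HN' : N t <> 0) by exact HN.
  assert (DN : is_derive N t (2 * (Re l * Re (f t) + Im l * Im (f t)))).
  { apply (is_derive_ext (fun s => Re (f s) * Re (f s) + Im (f s) * Im (f s))).
    { intro s. unfold N. simpl. ring. }
    replace (2 * (Re l * Re (f t) + Im l * Im (f t)))
      with ((Re l * Re (f t) + Re (f t) * Re l) + (Im l * Im (f t) + Im (f t) * Im l))
      by ring.
    apply (is_derive_plus (K := R_AbsRing) (V := R_NormedModule));
      now apply is_derive_Rmult. }
  split.
  - apply (is_derive_ext (fun s => Re (f s) / N s)); [easy|].
    evar (v : R). replace (Re _) with v; [apply is_derive_div; eassumption|].
    unfold v, N. simpl in *. unfold Re, Im in *. field. simpl in HN. lra.
  - apply (is_derive_ext (fun s => (- Im (f s)) / N s)); [easy|].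
    evar (v : R). replace (Im _) with v.
    { apply is_derive_div; [|eassumption|easy].
      apply (is_derive_opp (K := R_AbsRing) (V := R_NormedModule)); eassumption. }
    unfold v, N, opp. simpl in *. unfold Re, Im in *. field. simpl in HN. lra.
Qed.

Lemma derivable_C_continuous (f : R -> C) (t : R) (l : C) :
  derivable_C f t l -> forall eps, 0 < eps ->
  locally t (fun s => Cmod (f s - f t) < eps).
Proof.
  intros [H1 H2] eps Heps.
  assert (C1 : continuous (fun s => Re (f s)) t)
    by (apply (ex_derive_continuous (K := R_AbsRing) (V := R_NormedModule)); now exists (Re l)).
  assert (C2 : continuous (fun s => Im (f s)) t)
    by (apply (ex_derive_continuous (K := R_AbsRing) (V := R_NormedModule)); now exists (Im l)).
  assert (He : 0 < eps / 2) by lra.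
  generalize (proj1 (filterlim_locally _ _) C1 (mkposreal _ He))
    (proj1 (filterlim_locally _ _) C2 (mkposreal _ He)).
  intros L1 L2. generalize (filter_and _ _ L1 L2). apply filter_imp.
  intros s [B1 B2].
  change (Rabs (Re (f s) - Re (f t)) < eps / 2) in B1.
  change (Rabs (Im (f s) - Im (f t)) < eps / 2) in B2.
  replace (f s - f t)%C with (RtoC (Re (f s) - Re (f t))
     + Ci * RtoC (Im (f s) - Im (f t)))%C.
  - eapply Rle_lt_trans; [apply Cmod_triangle|].
    rewrite Cmod_mult, Cmod_Ci, !Cmod_R. lra.
  - apply injective_projections; simpl; unfold Re, Im; ring.
Qed.

Lemma derivable_C_nonzero (f : R -> C) (t : R) (l : C) :
  derivable_C f t l -> f t <> 0 -> locally t (fun s => f s <> 0).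
Proof.
  intros Hd Hne. generalize (derivable_C_continuous f t l Hd (Cmod (f t))
    ltac:(now apply Cmod_gt_0)).
  apply filter_imp. intros s Hs E. rewrite E in Hs.
  replace (0 - f t)%C with (- f t)%C in Hs by ring. rewrite Cmod_opp in Hs. lra.
Qed.

Lemma Cdiv_real (a : C) (s : R) :
  s <> 0 -> (a / RtoC s)%C = (Re a / s, Im a / s).
Proof.
  intro Hs. destruct a as [a1 a2].
  unfold Cdiv, Cmult, Cinv, Re, Im, RtoC. simpl.
  apply injective_projections; simpl; field; lra.
Qed.

Lemma difference_quotient_lim (g : R -> R) (t d : R) :
  is_derive g t d -> is_lim (fun x => (g x - g t) / (x - t)) t d.
Proof.
  intro Hd. apply is_derive_Reals in Hd.
  apply is_lim_spec. intro eps. destruct (Hd eps (cond_pos eps)) as [del Hdel].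
  exists del. intros y Hy Hne. change (Rabs (y - t) < del) in Hy.
  change R in y. assert (Hyt : y - t <> 0) by (intro; apply Hne; lra).
  specialize (Hdel (y - t) Hyt Hy).
  now replace (t + (y - t)) with y in Hdel by (simpl; ring).
Qed.

(** [C_derive] takes the limit of difference quotients along the horizontal line only, so
    at a real point it depends on the restriction of [f] to the real line. *)
Lemma C_derive_real (f : C -> C) (t : R) (l : C) :
  derivable_C (fun s => f (RtoC s)) t l -> C_derive f (RtoC t) = l.
Proof.
  intros [H1 H2]. apply difference_quotient_lim in H1, H2.
  assert (E : forall y : R, y <> t ->
    ((f (RtoC y) - f (RtoC t)) / (RtoC y - RtoC t))%C
    = ((Re (f (RtoC y)) - Re (f (RtoC t))) / (y - t),
       (Im (f (RtoC y)) - Im (f (RtoC t))) / (y - t))).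
  { intros y Hy. rewrite <- RtoC_minus, Cdiv_real by lra. reflexivity. }
  assert (L1 : is_lim (fun y : R => fst ((f (RtoC y) - f (RtoC t))
                 / (RtoC y - RtoC t))%C) t (Re l)).
  { eapply is_lim_ext_loc; [|exact H1].
    exists (mkposreal 1 Rlt_0_1). intros y _ Hne. now rewrite E. }
  assert (L2 : is_lim (fun y : R => snd ((f (RtoC y) - f (RtoC t))
                 / (RtoC y - RtoC t))%C) t (Im l)).
  { eapply is_lim_ext_loc; [|exact H2].
    exists (mkposreal 1 Rlt_0_1). intros y _ Hne. now rewrite E. }
  apply is_lim_unique in L1, L2.
  apply injective_projections.
  - exact (f_equal real L1).
  - exact (f_equal real L2).
Qed.

(** * Sums over the square lattice of indices *)

(** The index runs over [-N, ..., N]; the shape follows that of [wp_partial]. *)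
Definition sym_sum (g : Z -> R) (N : nat) : R :=
  sum_n (fun i => g (Z.of_nat i - Z.of_nat N)%Z) (2 * N).

Definition box_sum (g : Z -> Z -> R) (N : nat) : R :=
  sym_sum (fun m => sym_sum (g m) N) N.

Lemma sum_n_shift (f : nat -> R) (n : nat) :
  sum_n f (S n) = f 0%nat + sum_n (fun i => f (S i)) n.
Proof.
  induction n as [|n IH].
  - now rewrite sum_Sn, !sum_O.
  - rewrite sum_Sn, IH, (sum_Sn (fun i => f (S i))). unfold plus; simpl. ring.
Qed.

Lemma sym_sum_S (g : Z -> R) (N : nat) :
  sym_sum g (S N)
  = sym_sum g N + (g (Z.of_nat (S N)) + g (- Z.of_nat (S N))%Z).
Proof.
  unfold sym_sum.
  replace (2 * S N)%nat with (S (S (2 * N))) by lia.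
  rewrite sum_Sn, sum_n_shift. unfold plus; simpl plus.
  rewrite (sum_n_ext (fun i => g (Z.of_nat (S i) - Z.of_nat (S N))%Z)
             (fun i => g (Z.of_nat i - Z.of_nat N)%Z))
    by (intro i; f_equal; lia).
  replace (Z.of_nat 0 - Z.of_nat (S N))%Z with (- Z.of_nat (S N))%Z by lia.
  replace (Z.of_nat (S (S (2 * N))) - Z.of_nat (S N))%Z
    with (Z.of_nat (S N)) by lia.
  simpl. ring.
Qed.

Lemma sym_sum_ext (f g : Z -> R) (N : nat) :
  (forall m, f m = g m) -> sym_sum f N = sym_sum g N.
Proof. intro H. apply sum_n_ext. intro i. apply H. Qed.

Lemma sym_sum_plus (f g : Z -> R) (N : nat) :
  sym_sum (fun m => f m + g m) N = sym_sum f N + sym_sum g N.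
Proof. unfold sym_sum. now rewrite (sum_n_plus (G := R_AbelianMonoid)). Qed.

Lemma sym_sum_scal (a : R) (f : Z -> R) (N : nat) :
  sym_sum (fun m => a * f m) N = a * sym_sum f N.
Proof. unfold sym_sum. now rewrite <- (sum_n_mult_l (K := R_Ring)). Qed.

Lemma sym_sum_le (f : Z -> R) (B : R) (N : nat) :
  (forall m, (Z.abs m <= Z.of_nat N)%Z -> Rabs (f m) <= B) ->
  Rabs (sym_sum f N) <= (2 * INR N + 1) * B.
Proof.
  induction N as [|N IH]; intro H.
  - unfold sym_sum. simpl. rewrite sum_O.
    generalize (H 0%Z ltac:(lia)). simpl. lra.
  - rewrite sym_sum_S, S_INR.
    assert (H1 := H (Z.of_nat (S N)) ltac:(lia)).
    assert (H2 := H (- Z.of_nat (S N))%Z ltac:(lia)).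
    assert (H3 := IH (fun m Hm => H m ltac:(lia))).
    split_Rabs; lra.
Qed.

Lemma box_sum_ext (f g : Z -> Z -> R) (N : nat) :
  (forall m n, f m n = g m n) -> box_sum f N = box_sum g N.
Proof. intro H. apply sym_sum_ext; intro m. now apply sym_sum_ext. Qed.

Lemma box_sum_plus (f g : Z -> Z -> R) (N : nat) :
  box_sum (fun m n => f m n + g m n) N = box_sum f N + box_sum g N.
Proof.
  unfold box_sum. rewrite <- sym_sum_plus. apply sym_sum_ext; intro m.
  apply sym_sum_plus.
Qed.

Lemma box_sum_scal (a : R) (f : Z -> Z -> R) (N : nat) :
  box_sum (fun m n => a * f m n) N = a * box_sum f N.
Proof.
  unfold box_sum. rewrite <- sym_sum_scal. apply sym_sum_ext; intro m.
  apply sym_sum_scal.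
Qed.

(** The maximum norm of the index, cut off at 1 so that the origin needs no special
    treatment. *)
Definition box_norm (m n : Z) : R :=
  Rmax 1 (Rmax (Rabs (IZR m)) (Rabs (IZR n))).

Lemma box_norm_ge1 (m n : Z) : 1 <= box_norm m n.
Proof. apply Rmax_l. Qed.

Lemma box_norm_shell (N : nat) (m n : Z) :
  Z.max (Z.abs m) (Z.abs n) = Z.of_nat (S N) -> box_norm m n = INR (S N).
Proof.
  intro H. unfold box_norm. rewrite <- !abs_IZR, INR_IZR_INZ, <- H.
  destruct (Z.max_spec (Z.abs m) (Z.abs n)) as [[H1 H2]|[H1 H2]]; rewrite H2 in *;
  apply IZR_le in H1 || (apply IZR_lt in H1; apply Rlt_le in H1).
  - rewrite (Rmax_right (IZR _) (IZR _)) by easy. apply Rmax_right.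
    apply (IZR_le 1). lia.
  - rewrite (Rmax_left (IZR _) (IZR _)) by easy. apply Rmax_right.
    apply (IZR_le 1). lia.
Qed.

(** Cubic decay makes a double series converge: the shell [box_norm = k] has [8 k]
    points. *)
Definition cubic_decay (M : R) (g : Z -> Z -> R) : Prop :=
  forall m n, Rabs (g m n) <= M / box_norm m n ^ 3.

Lemma cubic_decay_nonneg (M : R) (g : Z -> Z -> R) : cubic_decay M g -> 0 <= M.
Proof.
  intro Hg.
  generalize (Hg 0%Z 0%Z) (Rabs_pos (g 0%Z 0%Z)). unfold box_norm.
  rewrite Rabs_R0, (Rmax_left 0 0), Rmax_left by lra. lra.
Qed.

(** The new shell consists of four sides of the square, with [8 (N + 1)] points in all. *)
Lemma box_sum_step (M : R) (g : Z -> Z -> R) (N : nat) :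
  cubic_decay M g ->
  Rabs (box_sum g (S N) - box_sum g N) <= 8 * M / INR (S N) ^ 2.
Proof.
  intro Hg. set (B := M / INR (S N) ^ 3).
  assert (HN : 0 < INR (S N)) by (apply lt_0_INR; lia).
  assert (HB : forall m n, Z.max (Z.abs m) (Z.abs n) = Z.of_nat (S N) ->
                Rabs (g m n) <= B).
  { intros m n H. unfold B. rewrite <- (box_norm_shell N m n H). apply Hg. }
  unfold box_sum. rewrite sym_sum_S.
  rewrite (sym_sum_ext (fun m => sym_sum (g m) (S N)) (fun m => sym_sum (g m) N +
    (g m (Z.of_nat (S N)) + g m (- Z.of_nat (S N))%Z)))
    by (intro m; apply sym_sum_S).
  rewrite !sym_sum_plus.
  assert (H1 := sym_sum_le (fun m => g m (Z.of_nat (S N))) B N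
                  ltac:(intros; apply HB; lia)).
  assert (H2 := sym_sum_le (fun m => g m (- Z.of_nat (S N))%Z) B N
                  ltac:(intros; apply HB; lia)).
  assert (H3 := sym_sum_le (g (Z.of_nat (S N))) B (S N)
                  ltac:(intros; apply HB; lia)).
  assert (H4 := sym_sum_le (g (- Z.of_nat (S N))%Z) B (S N)
                  ltac:(intros; apply HB; lia)).
  apply Rle_trans with (8 * INR (S N) * B).
  - revert H1 H2 H3 H4. rewrite S_INR. intros. split_Rabs; lra.
  - right. unfold B. field. lra.
Qed.

(** The shells contribute at most [8 M / k^2], and [1 / k^2 <= 1 / (k - 1) - 1 / k]
    telescopes. *)
Lemma box_sum_tail (M : R) (g : Z -> Z -> R) (n p : nat) :
  cubic_decay M g ->
  Rabs (box_sum g (S n + p) - box_sum g (S n))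
  <= 8 * M * (/ INR (S n) - / INR (S n + p)).
Proof.
  intro Hg.
  assert (HM := cubic_decay_nonneg M g Hg).
  induction p as [|p IH].
  - rewrite Nat.add_0_r, !Rminus_diag, Rabs_R0. lra.
  - replace (S n + S p)%nat with (S (S n + p)) by lia.
    generalize (box_sum_step M g (S n + p) Hg). intro H.
    assert (H1 : / INR (S (S n + p)) ^ 2
                 <= / INR (S n + p) - / INR (S (S n + p))).
    { rewrite (S_INR (S n + p)).
      assert (0 < INR (S n + p)) by (apply lt_0_INR; lia).
      set (a := INR (S n + p)) in *.
      replace (/ a - / (a + 1)) with (/ (a * (a + 1))) by (field; lra).
      apply Rinv_le_contravar; nra. }
    assert (H2 := Rmult_le_compat_l (8 * M) _ _ ltac:(lra) H1).
    unfold Rdiv in H. split_Rabs; lra.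
Qed.

Lemma box_sum_bound (M : R) (g : Z -> Z -> R) (N : nat) :
  cubic_decay M g -> Rabs (box_sum g N) <= 17 * M.
Proof.
  intro Hg. assert (HM := cubic_decay_nonneg M g Hg).
  assert (H0 : Rabs (box_sum g 0) <= M).
  { unfold box_sum, sym_sum. simpl. rewrite !sum_O.
    generalize (Hg 0%Z 0%Z). unfold box_norm.
    rewrite Rabs_R0, (Rmax_left 0 0), Rmax_left by lra. simpl. lra. }
  destruct N as [|N]; [lra|].
  assert (H1 := box_sum_step M g 0 Hg). simpl INR in H1.
  assert (H2 := box_sum_tail M g 0 N Hg). simpl INR in H2.
  replace (1 + N)%nat with (S N) in H2 by lia.
  assert (0 < / match N with 0%nat => 1 | S _ => INR N + 1 end).
  { apply Rinv_0_lt_compat. destruct N; [lra|]. generalize (pos_INR (S N)); lra. }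
  assert (H3 : 8 * M / 1 ^ 2 = 8 * M) by field.
  rewrite Rinv_1 in H2.
  split_Rabs; nra.
Qed.

Definition lattice_sum (g : Z -> Z -> R) : R := real (Lim_seq (box_sum g)).

Lemma lattice_sum_correct (M : R) (g : Z -> Z -> R) :
  cubic_decay M g -> is_lim_seq (box_sum g) (lattice_sum g).
Proof.
  intro Hg. assert (HM := cubic_decay_nonneg M g Hg).
  apply Lim_seq_correct', ex_lim_seq_cauchy_corr.
  intro eps.
  destruct (archimed_cor1 (eps / (16 * (M + 1)))) as [N [HN HN0]].
  { apply Rdiv_lt_0_compat; [apply cond_pos|lra]. }
  assert (HNp : 0 < INR N) by (apply lt_0_INR; lia).
  assert (HN' : 16 * (M + 1) * / INR N < eps).
  { apply Rmult_lt_compat_l with (r := 16 * (M + 1)) in HN; [|lra].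
    replace (16 * (M + 1) * (eps / (16 * (M + 1)))) with (eps : R) in HN
      by (field; lra). exact HN. }
  destruct N as [|N]; [lia|].
  assert (T : forall n, (S N <= n)%nat ->
            Rabs (box_sum g n - box_sum g (S N)) <= 8 * M * / INR (S N)).
  { intros n Hn. replace n with (S N + (n - S N))%nat by lia.
    eapply Rle_trans; [apply box_sum_tail, Hg|].
    apply Rmult_le_compat_l; [lra|].
    assert (0 < / INR (S N + (n - S N))).
    { apply Rinv_0_lt_compat, lt_0_INR; lia. }
    lra. }
  exists (S N). intros n m Hn Hm.
  assert (H1 := T n Hn). assert (H2 := T m Hm).
  assert (0 < / INR (S N)) by now apply Rinv_0_lt_compat.
  split_Rabs; nra.
Qed.

Lemma lattice_sum_bound (M : R) (g : Z -> Z -> R) :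
  cubic_decay M g -> Rabs (lattice_sum g) <= 17 * M.
Proof.
  intro Hg.
  apply (is_lim_seq_le (fun N => Rabs (box_sum g N)) (fun _ => 17 * M)
           (Rabs (lattice_sum g)) (17 * M)).
  - intro N. now apply box_sum_bound.
  - apply (is_lim_seq_abs (box_sum g) (lattice_sum g)).
    now apply (lattice_sum_correct M).
  - apply is_lim_seq_const.
Qed.

(** Termwise differentiation without uniform convergence of derivatives: a
    first-order Taylor bound on each term, uniform in the sense of cubic decay, adds up to
    the same bound for the sum because [lattice_sum] is linear and bounded. *)
Lemma lattice_sum_taylor (F : R -> Z -> Z -> R) (G : Z -> Z -> R)
  (h delta C C0 C1 : R) :
  0 < delta ->
  (forall e, Rabs e < delta -> cubic_decay C0 (F (h + e))) ->
  cubic_decay C1 G ->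
  (forall e, Rabs e < delta ->
    cubic_decay (C * e ^ 2) (fun m n => F (h + e) m n - F h m n - e * G m n)) ->
  is_derive (fun s => lattice_sum (F s)) h (lattice_sum G).
Proof.
  intros Hd HF HG HT.
  assert (Hlin : forall e, Rabs e < delta ->
    Rabs (lattice_sum (F (h + e)) - lattice_sum (F h) - e * lattice_sum G)
    <= 17 * (C * e ^ 2)).
  { intros e He.
    assert (HF0 : cubic_decay C0 (F h)).
    { rewrite <- (Rplus_0_r h). apply HF. now rewrite Rabs_R0. }
    assert (L1 := lattice_sum_correct _ _ (HF e He)).
    assert (L2 := lattice_sum_correct _ _ HF0).
    assert (L3 := lattice_sum_correct _ _ HG).
    assert (L4 : is_lim_seq
       (box_sum (fun m n => F (h + e) m n - F h m n - e * G m n))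
       (lattice_sum (F (h + e)) - lattice_sum (F h) - e * lattice_sum G)).
    { apply is_lim_seq_ext with
        (fun N => box_sum (F (h + e)) N - box_sum (F h) N - e * box_sum G N).
      - intro N.
        transitivity (box_sum (fun m n =>
          (F (h + e) m n + (-1) * F h m n) + (- e) * G m n) N).
        + rewrite !box_sum_plus, !box_sum_scal. ring.
        + apply box_sum_ext. intros. ring.
      - apply (is_lim_seq_minus' _ _ _ _ (is_lim_seq_minus' _ _ _ _ L1 L2)).
        apply (is_lim_seq_scal_l _ e _ L3). }
    assert (L5 : lattice_sum (fun m n => F (h + e) m n - F h m n - e * G m n)
      = lattice_sum (F (h + e)) - lattice_sum (F h) - e * lattice_sum G).
    { unfold lattice_sum at 1. now rewrite (is_lim_seq_unique _ _ L4). }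
    rewrite <- L5. apply lattice_sum_bound. now apply HT. }
  assert (HC : 0 <= C).
  { assert (H := cubic_decay_nonneg _ _ (HT (delta / 2) ltac:(split_Rabs; lra))).
    apply Rmult_le_reg_r with ((delta / 2) ^ 2); [apply pow_lt|]; lra. }
  apply is_derive_Reals. intros eps Heps.
  assert (Hd' : 0 < Rmin delta (eps / (17 * C + 1))).
  { apply Rmin_glb_lt; [easy|]. apply Rdiv_lt_0_compat; lra. }
  exists (mkposreal _ Hd'). intros e He0 He. simpl in He.
  assert (H1 : Rabs e < delta) by (eapply Rlt_le_trans; [exact He|apply Rmin_l]).
  assert (H2 : Rabs e < eps / (17 * C + 1))
    by (eapply Rlt_le_trans; [exact He|apply Rmin_r]).
  specialize (Hlin e H1).
  set (D := lattice_sum (F (h + e)) - lattice_sum (F h)) in *.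
  replace (D / e - lattice_sum G) with ((D - e * lattice_sum G) / e)
    by (field; easy).
  unfold Rdiv. rewrite Rabs_mult, Rabs_inv.
  assert (Hpos := Rabs_pos_lt e He0).
  apply Rmult_lt_reg_r with (Rabs e); [easy|].
  rewrite Rmult_assoc, Rinv_l, Rmult_1_r by lra.
  eapply Rle_lt_trans; [exact Hlin|].
  rewrite <- (pow2_abs e).
  assert (H3 : (17 * C + 1) * Rabs e < eps).
  { apply Rmult_lt_compat_l with (r := 17 * C + 1) in H2; [|lra].
    replace ((17 * C + 1) * (eps / (17 * C + 1))) with eps in H2 by (field; lra).
    exact H2. }
  nra.
Qed.

(** * Lattices in the complex plane *)

(** By Cramer's rule each coefficient is a quotient of [Im (l * conj w)] by the
    determinant of the basis. *)
Lemma lattice_pt_lower (w1 w2 : C) :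
  is_lattice_basis w1 w2 ->
  exists c : R, 0 < c /\ forall m n : Z,
    c * Rabs (IZR m) <= Cmod (lattice_pt w1 w2 m n) /\
    c * Rabs (IZR n) <= Cmod (lattice_pt w1 w2 m n).
Proof.
  intro hw. unfold is_lattice_basis in hw.
  set (D := Im (w1 * Cconj w2)%C) in *.
  assert (H1 := Cmod_ge_0 w1). assert (H2 := Cmod_ge_0 w2).
  assert (HD := Rabs_pos_lt D hw).
  exists (Rabs D / (Cmod w1 + Cmod w2 + 1)). split; [apply Rdiv_lt_0_compat; lra|].
  intros m n. set (l := lattice_pt w1 w2 m n).
  assert (Hl := Cmod_ge_0 l).
  assert (E1 : Im (l * Cconj w2)%C = IZR m * D).
  { unfold l, lattice_pt, D. destruct w1, w2; simpl. ring. }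
  assert (E2 : Im (l * Cconj w1)%C = - IZR n * D).
  { unfold l, lattice_pt, D. destruct w1, w2; simpl. ring. }
  assert (F1 : Rabs (IZR m) * Rabs D <= Cmod l * Cmod w2).
  { rewrite <- Rabs_mult, <- E1, <- (Cmod_conj w2), <- Cmod_mult.
    eapply Rle_trans; [apply Rmax_r|apply Rmax_Cmod]. }
  assert (F2 : Rabs (IZR n) * Rabs D <= Cmod l * Cmod w1).
  { rewrite <- (Rabs_Ropp (IZR n)), <- Rabs_mult, <- E2, <- (Cmod_conj w1),
      <- Cmod_mult.
    eapply Rle_trans; [apply Rmax_r|apply Rmax_Cmod]. }
  split.
  - apply Rmult_le_reg_r with (Cmod w1 + Cmod w2 + 1); [lra|].
    replace (Rabs D / (Cmod w1 + Cmod w2 + 1) * Rabs (IZR m) *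
      (Cmod w1 + Cmod w2 + 1)) with (Rabs (IZR m) * Rabs D) by (field; lra).
    nra.
  - apply Rmult_le_reg_r with (Cmod w1 + Cmod w2 + 1); [lra|].
    replace (Rabs D / (Cmod w1 + Cmod w2 + 1) * Rabs (IZR n) *
      (Cmod w1 + Cmod w2 + 1)) with (Rabs (IZR n) * Rabs D) by (field; lra).
    nra.
Qed.

Lemma lattice_pt_sub (w1 w2 : C) (m n m' n' : Z) :
  lattice_pt w1 w2 (m - m') (n - n')
  = (lattice_pt w1 w2 m n - lattice_pt w1 w2 m' n')%C.
Proof. unfold lattice_pt. rewrite !minus_IZR, !RtoC_minus. ring. Qed.

(** Differences of lattice points are lattice points, and a nonzero integer has absolute
    value at least 1. *)
Lemma lattice_pt_gap (w1 w2 : C) :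
  is_lattice_basis w1 w2 ->
  exists c : R, 0 < c /\
    (forall m n : Z, c * Rabs (IZR m) <= Cmod (lattice_pt w1 w2 m n) /\
       c * Rabs (IZR n) <= Cmod (lattice_pt w1 w2 m n)) /\
    (forall m n m' n' : Z, (m, n) <> (m', n') ->
       c <= Cmod (lattice_pt w1 w2 m n - lattice_pt w1 w2 m' n')).
Proof.
  intro hw. destruct (lattice_pt_lower w1 w2 hw) as [c [Hc H]].
  exists c. split; [easy|split; [exact H|]].
  intros m n m' n' Hne. rewrite <- lattice_pt_sub.
  assert (Hz : forall k : Z, k <> 0%Z -> 1 <= Rabs (IZR k)).
  { intros k Hk. rewrite <- abs_IZR. apply (IZR_le 1). lia. }
  destruct (Z.eq_dec m m') as [->|Hm].
  - destruct (Z.eq_dec n n') as [->|Hn]; [easy|].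
    assert (A := Hz (n - n')%Z ltac:(lia)).
    destruct (H (m' - m')%Z (n - n')%Z) as [_ B]. nra.
  - assert (A := Hz (m - m')%Z ltac:(lia)).
    destruct (H (m - m')%Z (n - n')%Z) as [B _]. nra.
Qed.

Lemma lattice_pt_inj (w1 w2 : C) (m n m' n' : Z) :
  is_lattice_basis w1 w2 ->
  lattice_pt w1 w2 m n = lattice_pt w1 w2 m' n' -> m = m' /\ n = n'.
Proof.
  intros hw E. destruct (lattice_pt_gap w1 w2 hw) as [c [Hc [_ H]]].
  destruct (Z.eq_dec m m') as [Hm|Hm], (Z.eq_dec n n') as [Hn|Hn]; try easy;
  (assert (A : (m, n) <> (m', n')) by congruence);
  specialize (H m n m' n' A); rewrite E in H;
  replace (lattice_pt w1 w2 m' n' - lattice_pt w1 w2 m' n')%C with (RtoC 0) in H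
    by ring; rewrite Cmod_0 in H; lra.
Qed.

(** At most one lattice point other than [z0] comes closer to [z0] than half the gap, so
    the distances to all of them have a positive minimum; for large indices the linear growth
    of [lattice_pt] takes over. *)
Lemma lattice_separation (w1 w2 z0 : C) :
  is_lattice_basis w1 w2 ->
  exists c delta : R, 0 < c /\ 0 < delta /\ forall (m n : Z) (h : C),
    z0 <> lattice_pt w1 w2 m n -> Cmod h < delta ->
    c * box_norm m n <= Cmod (z0 + h - lattice_pt w1 w2 m n).
Proof.
  intro hw. destruct (lattice_pt_gap w1 w2 hw) as [c [Hc [Hlow Hgap]]].
  assert (Hd : exists d, 0 < d /\ forall m n, z0 <> lattice_pt w1 w2 m n ->
                 d <= Cmod (z0 - lattice_pt w1 w2 m n)).
  { destruct (Classical_Prop.classic (exists m n, z0 <> lattice_pt w1 w2 m n /\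
      Cmod (z0 - lattice_pt w1 w2 m n) < c / 2)) as [[m0 [n0 [N0 L0]]]|Hno].
    - set (d := Cmod (z0 - lattice_pt w1 w2 m0 n0)) in *.
      assert (0 < d).
      { apply Cmod_gt_0. intro E. apply N0.
        replace z0 with (z0 - lattice_pt w1 w2 m0 n0 + lattice_pt w1 w2 m0 n0)%C
          by ring. rewrite E. ring. }
      exists d. split; [easy|]. intros m n Hne.
      destruct (Req_dec (IZR m) (IZR m0)) as [Em|Em];
      destruct (Req_dec (IZR n) (IZR n0)) as [En|En];
      [apply eq_IZR in Em; apply eq_IZR in En; subst; unfold d; lra| | |];
      (assert (A : (m, n) <> (m0, n0)) by (intro E; injection E; intros; subst; easy));
      specialize (Hgap m n m0 n0 A);
      generalize (Cmod_triangle (lattice_pt w1 w2 m n - z0)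
                    (z0 - lattice_pt w1 w2 m0 n0));
      replace (lattice_pt w1 w2 m n - z0 + (z0 - lattice_pt w1 w2 m0 n0))%C
        with (lattice_pt w1 w2 m n - lattice_pt w1 w2 m0 n0)%C by ring;
      rewrite <- (Cmod_opp (lattice_pt w1 w2 m n - z0));
      replace (- (lattice_pt w1 w2 m n - z0))%C
        with (z0 - lattice_pt w1 w2 m n)%C by ring; fold d; lra.
    - exists (c / 2). split; [lra|]. intros m n Hne.
      apply Rnot_lt_le. intro. apply Hno. now exists m, n. }
  destruct Hd as [d [Hd0 Hd]].
  assert (Hz := Cmod_ge_0 z0).
  set (A := 2 * (Cmod z0 + d) / c + 1).
  assert (HA : 1 <= A).
  { unfold A. enough (0 <= 2 * (Cmod z0 + d) / c) by lra.
    apply Rdiv_le_0_compat; lra. }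
  exists (Rmin (c / 2) (d / 2 / A)), (d / 2).
  assert (0 < d / 2 / A) by (apply Rdiv_lt_0_compat; lra).
  split; [apply Rmin_glb_lt; lra|]. split; [lra|].
  intros m n h Hne Hh. set (l := lattice_pt w1 w2 m n) in *.
  assert (Hb := box_norm_ge1 m n).
  destruct (Rle_lt_dec (box_norm m n) A) as [Hs|Hl].
  - apply Rle_trans with (d / 2 / A * A).
    + assert (P := Rmin_r (c / 2) (d / 2 / A)).
      assert (0 < Rmin (c / 2) (d / 2 / A)) by (apply Rmin_glb_lt; lra). nra.
    + replace (d / 2 / A * A) with (d / 2) by (field; lra).
      generalize (Cmod_triangle (z0 + h - l) (- h)). rewrite Cmod_opp.
      replace (z0 + h - l + - h)%C with (z0 - l)%C by ring.
      generalize (Hd m n Hne). fold l. lra.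
  - apply Rle_trans with (c / 2 * box_norm m n).
    + assert (P := Rmin_l (c / 2) (d / 2 / A)). nra.
    + assert (B : box_norm m n = Rabs (IZR m) \/ box_norm m n = Rabs (IZR n)).
      { unfold box_norm in *.
        destruct (Rmax_case_strong 1 (Rmax (Rabs (IZR m)) (Rabs (IZR n)))
          (fun v => v = 1 \/ v = Rmax (Rabs (IZR m)) (Rabs (IZR n)))
          ltac:(now left) ltac:(now right)) as [E|E]; [lra|].
        rewrite E. apply Rmax_case; [now left|now right]. }
      assert (C0 : c * box_norm m n <= Cmod l).
      { destruct (Hlow m n). destruct B as [-> | ->]; easy. }
      assert (D0 : 2 * (Cmod z0 + d) <= c * box_norm m n).
      { unfold A in Hl. apply Rle_trans with (c * (2 * (Cmod z0 + d) / c)).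
        - right; field; lra.
        - apply Rmult_le_compat_l; lra. }
      generalize (Cmod_triangle (z0 + h - l) (- (z0 + h))) (Cmod_triangle z0 h).
      rewrite Cmod_opp.
      replace (z0 + h - l + - (z0 + h))%C with (- l)%C by ring.
      rewrite Cmod_opp. lra.
Qed.

(** * The Weierstrass series along the real direction *)

Definition lattice_sum_C (g : Z -> Z -> C) : C :=
  (lattice_sum (fun m n => Re (g m n)), lattice_sum (fun m n => Im (g m n))).

Definition cubic_decay_C (M : R) (g : Z -> Z -> C) : Prop :=
  forall m n, Cmod (g m n) <= M / box_norm m n ^ 3.

Lemma Im_le_Cmod (z : C) : Rabs (Im z) <= Cmod z.
Proof. eapply Rle_trans; [apply Rmax_r|apply Rmax_Cmod]. Qed.

Lemma cubic_decay_Re (M : R) (g : Z -> Z -> C) :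
  cubic_decay_C M g -> cubic_decay M (fun m n => Re (g m n)).
Proof. intros H m n. eapply Rle_trans; [apply re_le_Cmod|apply H]. Qed.

Lemma cubic_decay_Im (M : R) (g : Z -> Z -> C) :
  cubic_decay_C M g -> cubic_decay M (fun m n => Im (g m n)).
Proof. intros H m n. eapply Rle_trans; [apply Im_le_Cmod|apply H]. Qed.

Lemma Re_sub_scal (a b c : C) (e : R) :
  Re (a - b - RtoC e * c)%C = Re a - Re b - e * Re c.
Proof. destruct a, b, c; simpl; ring. Qed.

Lemma Im_sub_scal (a b c : C) (e : R) :
  Im (a - b - RtoC e * c)%C = Im a - Im b - e * Im c.
Proof. destruct a, b, c; simpl; ring. Qed.

Lemma lattice_sum_C_taylor (F : R -> Z -> Z -> C) (G : Z -> Z -> C)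
  (h delta C C0 C1 : R) :
  0 < delta ->
  (forall e, Rabs e < delta -> cubic_decay_C C0 (F (h + e))) ->
  cubic_decay_C C1 G ->
  (forall e, Rabs e < delta -> cubic_decay_C (C * e ^ 2)
     (fun m n => F (h + e)%R m n - F h m n - RtoC e * G m n)%C) ->
  derivable_C (fun s => lattice_sum_C (F s)) h (lattice_sum_C G).
Proof.
  intros Hd HF HG HT. split; simpl.
  - apply (lattice_sum_taylor (fun s m n => Re (F s m n))
             (fun m n => Re (G m n)) h delta C C0 C1 Hd).
    + intros e He. now apply cubic_decay_Re, HF.
    + now apply cubic_decay_Re.
    + intros e He m n.
      replace (Re (F (h + e) m n) - Re (F h m n) - e * Re (G m n))
        with (Re (F (h + e)%R m n - F h m n - RtoC e * G m n)%C)
        by apply Re_sub_scal.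
      exact (cubic_decay_Re _ _ (HT e He) m n).
  - apply (lattice_sum_taylor (fun s m n => Im (F s m n))
             (fun m n => Im (G m n)) h delta C C0 C1 Hd).
    + intros e He. now apply cubic_decay_Im, HF.
    + now apply cubic_decay_Im.
    + intros e He m n.
      replace (Im (F (h + e) m n) - Im (F h m n) - e * Im (G m n))
        with (Im (F (h + e)%R m n - F h m n - RtoC e * G m n)%C)
        by apply Im_sub_scal.
      exact (cubic_decay_Im _ _ (HT e He) m n).
Qed.

Lemma Cinv_0 : (/ 0 = 0)%C.
Proof. unfold Cinv; simpl. apply injective_projections; simpl; unfold Rdiv; ring. Qed.

(** With [/ 0 = 0] this is also the correct term for [l = 0], namely [1 / z^2]. *)
Definition pole_term (l z : C) : C := ((/ (z - l)) ^ 2 - (/ l) ^ 2)%C.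
Definition pole_term' (l z : C) : C := (-2 * (/ (z - l)) ^ 3)%C.
Definition pole_term'' (l z : C) : C := (6 * (/ (z - l)) ^ 4)%C.

Lemma Cmod_inv_le (X : C) (b : R) : 0 < b -> b <= Cmod X -> Cmod (/ X) <= / b.
Proof.
  intros Hb HX. rewrite Cmod_inv by (apply Cmod_gt_0; lra).
  now apply Rinv_le_contravar.
Qed.

Lemma Cmod_mul_le (a b : C) (A B : R) :
  Cmod a <= A -> Cmod b <= B -> Cmod (a * b) <= A * B.
Proof.
  intros. rewrite Cmod_mult. apply Rmult_le_compat; auto using Cmod_ge_0.
Qed.

Lemma Cmod_pow_le (a : C) (A : R) (n : nat) :
  Cmod a <= A -> Cmod (a ^ n) <= A ^ n.
Proof. intros. rewrite Cmod_pow. apply pow_incr. split; auto using Cmod_ge_0. Qed.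

Lemma Cmod_nonzero (X : C) : 0 < Cmod X -> X <> 0.
Proof. intros H. now apply Cmod_gt_0. Qed.

(** The two squares differ by [z * p * q * (p - q)] with [p = 1 / (z - l)] and
    [q = 1 / l], which is cubic in the reciprocals. *)
Lemma pole_term_bound (l z : C) (B : R) :
  0 < B -> l <> 0 -> B <= Cmod l -> B <= Cmod (z - l) ->
  Cmod (pole_term l z) <= 2 * Cmod z * (/ B) ^ 3.
Proof.
  intros HB Hl H1 H2.
  assert (Hz : (z - l)%C <> 0) by (apply Cmod_nonzero; lra).
  unfold pole_term.
  replace ((/ (z - l)) ^ 2 - (/ l) ^ 2)%C
    with (z * (/ (z - l) * / l * (/ (z - l) - / l)))%C by (field; now split).
  apply Cmod_inv_le in H1; [|easy]. apply Cmod_inv_le in H2; [|easy].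
  replace (2 * Cmod z * (/ B) ^ 3)
    with (Cmod z * (/ B * / B * (/ B + / B))) by ring.
  apply Cmod_mul_le; [lra|]. apply Cmod_mul_le; [now apply Cmod_mul_le|].
  eapply Rle_trans; [apply Cmod_triangle|]. rewrite Cmod_opp. lra.
Qed.

(** In terms of the reciprocals [p] and [q] of [z - l] and [z + e - l] the remainder is
    exactly [e^2 (p^2 q^2 + 2 p^3 q)]. *)
Lemma pole_term_taylor (l z e : C) (B : R) :
  0 < B -> B <= Cmod (z - l) -> B <= Cmod (z + e - l) ->
  Cmod (pole_term l (z + e) - pole_term l z - e * pole_term' l z)
  <= 3 * Cmod e ^ 2 * (/ B) ^ 4.
Proof.
  intros HB H1 H2.
  assert (Hz : (z - l)%C <> 0) by (apply Cmod_nonzero; lra).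
  assert (Hz' : (z + e - l)%C <> 0) by (apply Cmod_nonzero; lra).
  unfold pole_term, pole_term'.
  set (p := (/ (z - l))%C). set (q := (/ (z + e - l))%C).
  assert (E : (q ^ 2 - (/ l) ^ 2 - (p ^ 2 - (/ l) ^ 2) - e * (-2 * p ^ 3)
    = e ^ 2 * (p ^ 2 * q ^ 2 + 2 * (p ^ 3 * q)))%C).
  { replace (q ^ 2 - (/ l) ^ 2 - (p ^ 2 - (/ l) ^ 2) - e * (-2 * p ^ 3))%C
      with (q ^ 2 - p ^ 2 + 2 * e * p ^ 3)%C by ring.
    unfold p, q. field. now split. }
  rewrite E. apply Cmod_inv_le in H1; [|easy]. apply Cmod_inv_le in H2; [|easy].
  fold p in H1. fold q in H2.
  replace (3 * Cmod e ^ 2 * (/ B) ^ 4)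
    with (Cmod e ^ 2 * ((/ B) ^ 2 * (/ B) ^ 2 + 2 * ((/ B) ^ 3 * / B))) by ring.
  apply Cmod_mul_le; [now rewrite Cmod_pow; right|].
  eapply Rle_trans; [apply Cmod_triangle|]. apply Rplus_le_compat.
  - apply Cmod_mul_le; now apply Cmod_pow_le.
  - apply Cmod_mul_le; [rewrite Cmod_R, Rabs_right; lra|].
    apply Cmod_mul_le; [now apply Cmod_pow_le|easy].
Qed.

Lemma pole_term'_taylor (l z e : C) (B : R) :
  0 < B -> B <= Cmod (z - l) -> B <= Cmod (z + e - l) ->
  Cmod (pole_term' l (z + e) - pole_term' l z - e * pole_term'' l z)
  <= 12 * Cmod e ^ 2 * (/ B) ^ 5.
Proof.
  intros HB H1 H2.
  assert (Hz : (z - l)%C <> 0) by (apply Cmod_nonzero; lra).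
  assert (Hz' : (z + e - l)%C <> 0) by (apply Cmod_nonzero; lra).
  unfold pole_term', pole_term''.
  set (p := (/ (z - l))%C). set (q := (/ (z + e - l))%C).
  assert (E : (-2 * q ^ 3 - -2 * p ^ 3 - e * (6 * p ^ 4)
    = e ^ 2 * (-2 * (p ^ 2 * q ^ 3) + -4 * (p ^ 3 * q ^ 2) + -6 * (p ^ 4 * q)))%C).
  { unfold p, q. field. now split. }
  rewrite E. apply Cmod_inv_le in H1; [|easy]. apply Cmod_inv_le in H2; [|easy].
  fold p in H1. fold q in H2.
  replace (12 * Cmod e ^ 2 * (/ B) ^ 5)
    with (Cmod e ^ 2 * (2 * ((/ B) ^ 2 * (/ B) ^ 3) + 4 * ((/ B) ^ 3 * (/ B) ^ 2)
      + 6 * ((/ B) ^ 4 * / B))) by ring.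
  apply Cmod_mul_le; [now rewrite Cmod_pow; right|].
  eapply Rle_trans; [apply Cmod_triangle|]. apply Rplus_le_compat.
  eapply Rle_trans; [apply Cmod_triangle|]. apply Rplus_le_compat.
  - apply Cmod_mul_le; [rewrite Cmod_R; split_Rabs; lra|].
    apply Cmod_mul_le; now apply Cmod_pow_le.
  - apply Cmod_mul_le; [rewrite Cmod_R; split_Rabs; lra|].
    apply Cmod_mul_le; now apply Cmod_pow_le.
  - apply Cmod_mul_le; [rewrite Cmod_R; split_Rabs; lra|].
    apply Cmod_mul_le; [now apply Cmod_pow_le|easy].
Qed.

(** The family of terms without the one that is singular at [z0], if there is one. *)
Definition off_pole (w1 w2 z0 : C) (f : C -> C) (m n : Z) : C :=
  if Ceq_dec z0 (lattice_pt w1 w2 m n) then RtoC 0 else f (lattice_pt w1 w2 m n).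

Lemma inv_pow_decay (c b : R) (k : nat) :
  0 < c -> 1 <= b -> (3 <= k)%nat -> (/ (c * b)) ^ k <= (/ c) ^ k / b ^ 3.
Proof.
  intros Hc Hb Hk. rewrite Rinv_mult, Rpow_mult_distr.
  apply Rmult_le_compat_l; [left; apply pow_lt, Rinv_0_lt_compat, Hc|].
  rewrite pow_inv. apply Rinv_le_contravar; [apply pow_lt; lra|].
  now apply Rle_pow.
Qed.

(** The Weierstrass series without its term singular at [z0], and the two series of
    termwise derivatives, in the direction of the real axis. *)
Lemma wp_regular_part (w1 w2 z0 : C) :
  is_lattice_basis w1 w2 ->
  exists (delta M : R) (g g1 g2 : R -> C), 0 < delta /\
    (forall h, Rabs h < delta ->
       g h = lattice_sum_C (off_pole w1 w2 z0 (fun l => pole_term l (z0 + h))) /\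
       cubic_decay_C M (off_pole w1 w2 z0 (fun l => pole_term l (z0 + h))) /\
       derivable_C g h (g1 h) /\ derivable_C g1 h (g2 h)) /\
    (forall h m n, Rabs h < delta -> z0 <> lattice_pt w1 w2 m n ->
       (z0 + h)%C <> lattice_pt w1 w2 m n).
Proof.
  intro hw.
  destruct (lattice_separation w1 w2 z0 hw) as [c [d [Hc [Hd Hsep]]]].
  destruct (lattice_separation w1 w2 0 hw) as [c' [d' [Hc' [Hd' Hsep']]]].
  assert (Hlow : forall m n, lattice_pt w1 w2 m n <> 0 ->
            c' * box_norm m n <= Cmod (lattice_pt w1 w2 m n)).
  { intros m n Hne. replace (Cmod (lattice_pt w1 w2 m n))
      with (Cmod (0 + 0 - lattice_pt w1 w2 m n)).
    - apply Hsep'; [congruence|now rewrite Cmod_0].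
    - rewrite <- Cmod_opp. f_equal. ring. }
  set (k := Rmin c c').
  assert (Hk : 0 < k) by now apply Rmin_glb_lt.
  assert (Kc : k <= c) by apply Rmin_l. assert (Kc' : k <= c') by apply Rmin_r.
  assert (Hsepk : forall m n (h : R), Rabs h < d -> z0 <> lattice_pt w1 w2 m n ->
     k * box_norm m n <= Cmod (z0 + h - lattice_pt w1 w2 m n)).
  { intros m n h Hh Hne. eapply Rle_trans; [|apply Hsep; [easy|]].
    - assert (B := box_norm_ge1 m n). nra.
    - now rewrite Cmod_R. }
  assert (Hkb : forall m n, 0 < k * box_norm m n).
  { intros. assert (B := box_norm_ge1 m n). nra. }
  assert (Hzd : forall h, Rabs h < d -> Cmod (z0 + h) <= Cmod z0 + d).
  { intros h Hh. eapply Rle_trans; [apply Cmod_triangle|].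
    rewrite Cmod_R. lra. }
  set (Q := Cmod z0 + d).
  assert (HQ : 0 < Q) by (unfold Q; generalize (Cmod_ge_0 z0); lra).
  set (M := 2 * Q * (/ k) ^ 3 + (/ k) ^ 2).
  assert (Hik : 0 < / k) by now apply Rinv_0_lt_compat.
  assert (Hpos : forall (C : R) m n, 0 <= C -> 0 <= C / box_norm m n ^ 3).
  { intros C m n HC. apply Rdiv_le_0_compat; [easy|].
    apply pow_lt. generalize (box_norm_ge1 m n); lra. }
  assert (D0 : forall h, Rabs h < d ->
     cubic_decay_C M (off_pole w1 w2 z0 (fun l => pole_term l (z0 + h)))).
  { intros h Hh m n. unfold off_pole. assert (Hb := box_norm_ge1 m n).
    assert (HM : 0 <= M).
    { unfold M. assert (0 < (/ k) ^ 3) by now apply pow_lt.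
      assert (0 < (/ k) ^ 2) by now apply pow_lt. nra. }
    destruct (Ceq_dec z0 (lattice_pt w1 w2 m n)) as [_|Hne].
    - rewrite Cmod_0. now apply Hpos.
    - destruct (Ceq_dec (lattice_pt w1 w2 m n) 0) as [E0|E0].
      + assert (Emn : m = 0%Z /\ n = 0%Z).
        { apply (lattice_pt_inj w1 w2); [easy|].
          rewrite E0. unfold lattice_pt. ring. }
        assert (S := Hsepk m n h Hh Hne).
        destruct Emn as [-> ->].
        assert (Eb : box_norm 0 0 = 1).
        { unfold box_norm. rewrite Rabs_R0, (Rmax_left 0 0), Rmax_left; lra. }
        rewrite Eb in *. rewrite E0 in *. unfold pole_term.
        rewrite Cinv_0.
        replace ((/ (z0 + h - 0)) ^ 2 - 0 ^ 2)%C with ((/ (z0 + h - 0)) ^ 2)%C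
          by ring.
        rewrite Rmult_1_r in S. apply Cmod_inv_le in S; [|easy].
        eapply Rle_trans; [apply Cmod_pow_le, S|].
        unfold M. assert (0 < (/ k) ^ 3) by now apply pow_lt.
        rewrite pow1, Rdiv_1_r. nra.
      + eapply Rle_trans; [apply (pole_term_bound _ _ (k * box_norm m n))|].
        * apply Hkb.
        * easy.
        * eapply Rle_trans; [|now apply Hlow]. nra.
        * now apply Hsepk.
        * assert (I := inv_pow_decay k (box_norm m n) 3 Hk Hb ltac:(lia)).
          assert (I0 : 0 <= (/ (k * box_norm m n)) ^ 3).
          { left. apply pow_lt, Rinv_0_lt_compat, Hkb. }
          apply Rle_trans with (2 * Q * ((/ k) ^ 3 / box_norm m n ^ 3)).
          -- assert (Hq := Hzd h Hh). fold Q in Hq.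
             apply Rmult_le_compat; try lra.
             generalize (Cmod_ge_0 (z0 + h)); lra.
          -- unfold M, Rdiv. assert (0 <= (/k)^2 * / box_norm m n ^ 3).
             { apply Hpos. left. now apply pow_lt. } lra. }
  assert (Hinvb : forall m n (h : R) j, Rabs h < d -> (3 <= j)%nat ->
     z0 <> lattice_pt w1 w2 m n ->
     Cmod ((/ (z0 + h - lattice_pt w1 w2 m n)) ^ j)
       <= (/ k) ^ j / box_norm m n ^ 3).
  { intros m n h j Hh Hj Hne.
    eapply Rle_trans; [apply Cmod_pow_le, Cmod_inv_le; [apply Hkb|now apply Hsepk]|].
    apply inv_pow_decay; [easy|apply box_norm_ge1|easy]. }
  assert (D1 : forall h, Rabs h < d -> cubic_decay_C (2 * (/ k) ^ 3)
     (off_pole w1 w2 z0 (fun l => pole_term' l (z0 + h)))).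
  { intros h Hh m n. unfold off_pole.
    destruct (Ceq_dec z0 (lattice_pt w1 w2 m n)) as [_|Hne].
    - rewrite Cmod_0. apply Hpos. assert (0 < (/ k) ^ 3) by now apply pow_lt. lra.
    - unfold pole_term', Rdiv. rewrite Rmult_assoc.
      apply Cmod_mul_le; [rewrite Cmod_R; split_Rabs; lra|].
      now apply Hinvb. }
  assert (D2 : forall h, Rabs h < d -> cubic_decay_C (6 * (/ k) ^ 4)
     (off_pole w1 w2 z0 (fun l => pole_term'' l (z0 + h)))).
  { intros h Hh m n. unfold off_pole.
    destruct (Ceq_dec z0 (lattice_pt w1 w2 m n)) as [_|Hne].
    - rewrite Cmod_0. apply Hpos. assert (0 < (/ k) ^ 4) by now apply pow_lt. lra.
    - unfold pole_term'', Rdiv. rewrite Rmult_assoc.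
      apply Cmod_mul_le; [rewrite Cmod_R; split_Rabs; lra|].
      apply Hinvb; [easy|lia|easy]. }
  exists d, M,
    (fun h => lattice_sum_C (off_pole w1 w2 z0 (fun l => pole_term l (z0 + RtoC h)))),
    (fun h => lattice_sum_C (off_pole w1 w2 z0 (fun l => pole_term' l (z0 + RtoC h)))),
    (fun h => lattice_sum_C (off_pole w1 w2 z0 (fun l => pole_term'' l (z0 + RtoC h)))).
  split; [easy|]. split.
  - intros h Hh. split; [easy|]. split; [now apply D0|].
    assert (Hr : 0 < d - Rabs h) by lra.
    assert (Hin : forall e, Rabs e < d - Rabs h -> Rabs (h + e) < d).
    { intros e He. generalize (Rabs_triang h e). lra. }
    split.
    + apply (lattice_sum_C_taylor
        (fun s => off_pole w1 w2 z0 (fun l => pole_term l (z0 + RtoC s)))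
        _ h (d - Rabs h) (3 * (/ k) ^ 4) M (2 * (/ k) ^ 3) Hr).
      * intros e He. now apply D0, Hin.
      * now apply D1.
      * intros e He m n. unfold off_pole.
        destruct (Ceq_dec z0 (lattice_pt w1 w2 m n)) as [_|Hne].
        -- replace (0 - 0 - e * 0)%C with (RtoC 0) by ring. rewrite Cmod_0.
           apply Hpos. assert (0 < (/ k) ^ 4) by now apply pow_lt. nra.
        -- rewrite RtoC_plus, Cplus_assoc.
           eapply Rle_trans; [apply (pole_term_taylor _ _ _ (k * box_norm m n))|].
           ++ apply Hkb.
           ++ now apply Hsepk.
           ++ rewrite <- Cplus_assoc, <- RtoC_plus. now apply Hsepk; [apply Hin|].
           ++ rewrite Cmod_R, pow2_abs.
              replace (3 * (/ k) ^ 4 * e ^ 2 / box_norm m n ^ 3)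
                with (3 * e ^ 2 * ((/ k) ^ 4 / box_norm m n ^ 3))
                by (unfold Rdiv; ring).
              apply Rmult_le_compat_l; [nra|].
              apply inv_pow_decay; [easy|apply box_norm_ge1|lia].
    + apply (lattice_sum_C_taylor
        (fun s => off_pole w1 w2 z0 (fun l => pole_term' l (z0 + RtoC s)))
        _ h (d - Rabs h) (12 * (/ k) ^ 5) (2 * (/ k) ^ 3) (6 * (/ k) ^ 4) Hr).
      * intros e He. now apply D1, Hin.
      * now apply D2.
      * intros e He m n. unfold off_pole.
        destruct (Ceq_dec z0 (lattice_pt w1 w2 m n)) as [_|Hne].
        -- replace (0 - 0 - e * 0)%C with (RtoC 0) by ring. rewrite Cmod_0.
           apply Hpos. assert (0 < (/ k) ^ 5) by now apply pow_lt. nra.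
        -- rewrite RtoC_plus, Cplus_assoc.
           eapply Rle_trans; [apply (pole_term'_taylor _ _ _ (k * box_norm m n))|].
           ++ apply Hkb.
           ++ now apply Hsepk.
           ++ rewrite <- Cplus_assoc, <- RtoC_plus. now apply Hsepk; [apply Hin|].
           ++ rewrite Cmod_R, pow2_abs.
              replace (12 * (/ k) ^ 5 * e ^ 2 / box_norm m n ^ 3)
                with (12 * e ^ 2 * ((/ k) ^ 5 / box_norm m n ^ 3))
                by (unfold Rdiv; ring).
              apply Rmult_le_compat_l; [nra|].
              apply inv_pow_decay; [easy|apply box_norm_ge1|lia].
  - intros h m n Hh Hne E. assert (S := Hsepk m n h Hh Hne).
    assert (P := Hkb m n). rewrite E in S.
    replace (lattice_pt w1 w2 m n - lattice_pt w1 w2 m n)%C with (RtoC 0) in S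
      by ring. rewrite Cmod_0 in S. lra.
Qed.

Lemma sym_sum_single (k : Z) (v : R) (N : nat) :
  sym_sum (fun m => if Z.eqb m k then v else 0) N
  = if Z.leb (Z.abs k) (Z.of_nat N) then v else 0.
Proof.
  induction N as [|N IH].
  - unfold sym_sum. change (2 * 0)%nat with 0%nat. rewrite sum_O.
    change (Z.of_nat 0 - Z.of_nat 0)%Z with 0%Z. change (Z.of_nat 0) with 0%Z.
    destruct (Z.eqb_spec 0 k), (Z.leb_spec (Z.abs k) 0); try lia; easy.
  - rewrite sym_sum_S, IH.
    destruct (Z.eqb_spec (Z.of_nat (S N)) k), (Z.eqb_spec (- Z.of_nat (S N)) k),
      (Z.leb_spec (Z.abs k) (Z.of_nat N)), (Z.leb_spec (Z.abs k) (Z.of_nat (S N)));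
      try lia; lra.
Qed.

Lemma box_sum_single (k l : Z) (v : R) (N : nat) :
  (Z.abs k <= Z.of_nat N)%Z -> (Z.abs l <= Z.of_nat N)%Z ->
  box_sum (fun m n => if (Z.eqb m k && Z.eqb n l)%bool then v else 0) N = v.
Proof.
  intros Hk Hl. unfold box_sum.
  rewrite (sym_sum_ext _ (fun m => if Z.eqb m k then v else 0)).
  - rewrite sym_sum_single. destruct (Z.leb_spec (Z.abs k) (Z.of_nat N)); lia || easy.
  - intro m. destruct (Z.eqb m k); simpl.
    + rewrite sym_sum_single.
      destruct (Z.leb_spec (Z.abs l) (Z.of_nat N)); lia || easy.
    + rewrite (sym_sum_ext _ (fun _ => 0 * 0)) by (intro; ring).
      rewrite sym_sum_scal. ring.
Qed.

Lemma Re_sum_n (f : nat -> C) (n : nat) : Re (sum_n f n) = sum_n (fun i => Re (f i)) n.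
Proof.
  induction n as [|n IH]; [now rewrite !sum_O|].
  rewrite !sum_Sn, <- IH. reflexivity.
Qed.

Lemma Im_sum_n (f : nat -> C) (n : nat) : Im (sum_n f n) = sum_n (fun i => Im (f i)) n.
Proof.
  induction n as [|n IH]; [now rewrite !sum_O|].
  rewrite !sum_Sn, <- IH. reflexivity.
Qed.

Lemma Cpow2_inv (a : C) : ((/ a) ^ 2 = 1 / a ^ 2)%C.
Proof.
  destruct (Ceq_dec a 0) as [->|Ha].
  - replace (0 ^ 2)%C with (RtoC 0) by ring. unfold Cdiv. rewrite Cinv_0. ring.
  - field. easy.
Qed.

(** The summand [1 / z^2] in front of the double sum is the term of index [(0, 0)]. *)
Lemma wp_partial_box (w1 w2 z : C) (N : nat) :
  is_lattice_basis w1 w2 ->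
  Re (wp_partial w1 w2 z N)
    = box_sum (fun m n => Re (pole_term (lattice_pt w1 w2 m n) z)) N /\
  Im (wp_partial w1 w2 z N)
    = box_sum (fun m n => Im (pole_term (lattice_pt w1 w2 m n) z)) N.
Proof.
  intro hw.
  assert (E : forall m n, pole_term (lattice_pt w1 w2 m n) z
    = ((if (Z.eqb m 0 && Z.eqb n 0)%bool then 1 / z ^ 2 else 0)
       + wp_term w1 w2 z m n)%C).
  { intros m n. unfold wp_term, pole_term. rewrite !Cpow2_inv.
    destruct (Z.eqb_spec m 0) as [->|Hm]; simpl; [|ring].
    destruct (Z.eqb_spec n 0) as [->|Hn]; simpl; [|ring].
    replace (lattice_pt w1 w2 0 0) with (RtoC 0) by (unfold lattice_pt; ring).
    rewrite !Cmult_1_r. replace (z - 0)%C with z by ring.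
    unfold Cdiv. rewrite Cmult_0_l, Cinv_0. ring. }
  unfold wp_partial. rewrite re_plus, im_plus, Re_sum_n, Im_sum_n.
  split.
  - rewrite (box_sum_ext _ (fun m n => (if (Z.eqb m 0 && Z.eqb n 0)%bool
      then Re (1 / z ^ 2)%C else 0) + Re (wp_term w1 w2 z m n))).
    + rewrite box_sum_plus, box_sum_single by lia. f_equal.
      apply sum_n_ext. intro i. apply Re_sum_n.
    + intros m n. rewrite E, re_plus.
      destruct (Z.eqb m 0 && Z.eqb n 0)%bool; easy.
  - rewrite (box_sum_ext _ (fun m n => (if (Z.eqb m 0 && Z.eqb n 0)%bool
      then Im (1 / z ^ 2)%C else 0) + Im (wp_term w1 w2 z m n))).
    + rewrite box_sum_plus, box_sum_single by lia. f_equal.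
      apply sum_n_ext. intro i. apply Im_sum_n.
    + intros m n. rewrite E, im_plus.
      destruct (Z.eqb m 0 && Z.eqb n 0)%bool; easy.
Qed.

Lemma pair_Cplus (a b : R) (v : C) : ((a, b) + v)%C = (a + Re v, b + Im v).
Proof. reflexivity. Qed.

Lemma wp_box (w1 w2 z : C) :
  is_lattice_basis w1 w2 ->
  wp w1 w2 z
  = (real (Lim_seq (box_sum (fun m n => Re (pole_term (lattice_pt w1 w2 m n) z)))),
     real (Lim_seq (box_sum (fun m n => Im (pole_term (lattice_pt w1 w2 m n) z))))).
Proof.
  intro hw. unfold wp.
  f_equal; f_equal; apply Lim_seq_ext; intro N; now apply wp_partial_box.
Qed.

Lemma Lim_seq_box_sum_split (M : R) (f g : Z -> Z -> R) (k l : Z) (v : R) :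
  cubic_decay M g ->
  (forall m n, f m n = g m n + (if (Z.eqb m k && Z.eqb n l)%bool then v else 0)) ->
  real (Lim_seq (box_sum f)) = lattice_sum g + v.
Proof.
  intros Hg Hf.
  rewrite (is_lim_seq_unique (box_sum f) (lattice_sum g + v)); [reflexivity|].
  apply is_lim_seq_ext_loc with (fun N => box_sum g N + v).
  - exists (Z.to_nat (Z.max (Z.abs k) (Z.abs l))). intros N HN.
    rewrite (box_sum_ext f _ N Hf), box_sum_plus, box_sum_single; [easy|lia|lia].
  - apply (is_lim_seq_plus' _ _ _ _ (lattice_sum_correct M g Hg)
             (is_lim_seq_const v)).
Qed.

(** [eps] is 1 at a lattice point and 0 elsewhere; the term left out of the regular part
    contributes [1 / h^2] and a constant, which is absorbed in [g]. *)
Lemma wp_local (w1 w2 z0 : C) :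
  is_lattice_basis w1 w2 ->
  exists (delta : R) (eps : C) (g g1 g2 : R -> C), 0 < delta /\
    (in_lattice w1 w2 z0 /\ eps = 1 \/ ~ in_lattice w1 w2 z0 /\ eps = 0) /\
    (forall h, Rabs h < delta ->
       derivable_C g h (g1 h) /\ derivable_C g1 h (g2 h)) /\
    (forall h, Rabs h < delta -> h <> 0 \/ ~ in_lattice w1 w2 z0 ->
       ~ in_lattice w1 w2 (z0 + h) /\
       wp w1 w2 (z0 + h) = (eps * (/ h) ^ 2 + g h)%C).
Proof.
  intro hw.
  destruct (wp_regular_part w1 w2 z0 hw) as [d [M [g [g1 [g2 [Hd [Hg Hoff]]]]]]].
  destruct (Classical_Prop.classic (in_lattice w1 w2 z0)) as [Hin|Hout].
  - destruct Hin as [m0 [n0 E0]].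
    exists d, 1, (fun h => (g h - (/ z0) ^ 2)%C), g1, g2.
    split; [easy|]. split; [left; split; [now exists m0, n0|easy]|]. split.
    + intros h Hh. destruct (Hg h Hh) as [_ [_ [H1 H2]]]. split; [|easy].
      replace (g1 h) with (g1 h - 0)%C by ring.
      apply derivable_C_minus; [exact H1|apply derivable_C_const].
    + intros h Hh [Hne|Hn]; [|exfalso; apply Hn; now exists m0, n0].
      assert (Hl : ~ in_lattice w1 w2 (z0 + h)).
      { intros [m [n E]]. destruct (Ceq_dec z0 (lattice_pt w1 w2 m n)) as [E'|E'].
        - apply Hne. apply RtoC_inj.
          replace (RtoC h) with (z0 + h - z0)%C by ring.
          rewrite E, E'. ring.
        - now apply (Hoff h m n Hh E'). }
      split; [easy|].
      destruct (Hg h Hh) as [Eg [Dg _]].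
      set (v := (((/ h) ^ 2 - (/ z0) ^ 2))%C).
      assert (Hsplit : forall m n, pole_term (lattice_pt w1 w2 m n) (z0 + h)
        = (off_pole w1 w2 z0 (fun l => pole_term l (z0 + h)) m n
           + if (Z.eqb m m0 && Z.eqb n n0)%bool then v else 0)%C).
      { intros m n. unfold off_pole.
        destruct (Ceq_dec z0 (lattice_pt w1 w2 m n)) as [E'|E'].
        - assert (I : m = m0 /\ n = n0)
            by (apply (lattice_pt_inj w1 w2); [easy|congruence]).
          destruct I as [-> ->]. rewrite !Z.eqb_refl; simpl andb.
          rewrite <- E0. unfold pole_term, v.
          replace (z0 + h - z0)%C with (RtoC h) by ring. ring.
        - destruct (Z.eqb_spec m m0), (Z.eqb_spec n n0); simpl; subst; easy || ring. }
      transitivity (g h + v)%C; [|unfold v; ring].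
      rewrite Eg, (wp_box w1 w2 _ hw). unfold lattice_sum_C.
      rewrite pair_Cplus. f_equal.
      * apply (Lim_seq_box_sum_split M _ _ m0 n0 _ (cubic_decay_Re _ _ Dg)).
        intros m n. cbv beta. rewrite Hsplit, re_plus.
           destruct (Z.eqb m m0 && Z.eqb n n0)%bool; easy.
      * apply (Lim_seq_box_sum_split M _ _ m0 n0 _ (cubic_decay_Im _ _ Dg)).
        intros m n. cbv beta. rewrite Hsplit, im_plus.
           destruct (Z.eqb m m0 && Z.eqb n n0)%bool; easy.
  - exists d, 0, g, g1, g2.
    split; [easy|]. split; [now right|]. split.
    + intros h Hh. now destruct (Hg h Hh) as [_ [_ H]].
    + intros h Hh _.
      assert (Hne : forall m n, z0 <> lattice_pt w1 w2 m n).
      { intros m n E. apply Hout. now exists m, n. }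
      split.
      { intros [m [n E]]. now apply (Hoff h m n Hh (Hne m n)). }
      destruct (Hg h Hh) as [Eg [Dg _]].
      transitivity (g h + 0)%C; [|ring].
      assert (Hsplit : forall m n, pole_term (lattice_pt w1 w2 m n) (z0 + h)
        = off_pole w1 w2 z0 (fun l => pole_term l (z0 + h)) m n).
      { intros m n. unfold off_pole.
        destruct (Ceq_dec z0 (lattice_pt w1 w2 m n)) as [E'|E']; [|easy].
        now elim (Hne m n). }
      rewrite Eg, (wp_box w1 w2 _ hw). unfold lattice_sum_C.
      rewrite pair_Cplus. f_equal.
      * apply (Lim_seq_box_sum_split M _ _ 0 0 _ (cubic_decay_Re _ _ Dg)).
        intros m n. cbv beta. rewrite Hsplit.
           destruct (Z.eqb m 0 && Z.eqb n 0)%bool; symmetry; apply Rplus_0_r.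
      * apply (Lim_seq_box_sum_split M _ _ 0 0 _ (cubic_decay_Im _ _ Dg)).
        intros m n. cbv beta. rewrite Hsplit.
           destruct (Z.eqb m 0 && Z.eqb n 0)%bool; symmetry; apply Rplus_0_r.
Qed.

(** * Uniqueness for the second-order equation *)

(** [exp (- K t) * E t] is nonincreasing. *)
Lemma gronwall_zero (E E' : R -> R) (K b : R) :
  (forall t, 0 <= t < b -> is_derive E t (E' t)) ->
  (forall t, 0 < t < b -> E' t <= K * E t) ->
  E 0 = 0 -> forall t, 0 <= t < b -> E t <= 0.
Proof.
  intros HD HE H0 t Ht. destruct (Req_dec t 0) as [->|Hne]; [lra|].
  set (G := fun s => exp (- K * s) * E s).
  set (G' := fun s => exp (- K * s) * (E' s - K * E s)).
  assert (DG : forall s, 0 <= s < b -> is_derive G s (G' s)).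
  { intros s Hs. unfold G.
    replace (G' s) with ((- K * exp (- K * s)) * E s + exp (- K * s) * E' s)
      by (unfold G'; ring).
    apply (is_derive_Rmult (fun x => exp (- K * x)) E); [|now apply HD]. auto_derive; [easy|ring]. }
  assert (E0 : Rmin 0 t = 0) by (apply Rmin_left; lra).
  assert (E1 : Rmax 0 t = t) by (apply Rmax_right; lra).
  destruct (MVT_cor2 G G' 0 t) as [c [Hc1 Hc2]].
  - lra.
  - intros s Hs. apply is_derive_Reals, DG. lra.
  - assert (A : G' c <= 0).
    { unfold G'. generalize (exp_pos (- K * c)) (HE c ltac:(lra)). intros. nra. }
    assert (B : G t <= G 0) by nra.
    unfold G in B. rewrite H0 in B. generalize (exp_pos (- K * t)). nra.
Qed.

Lemma Cmod_sqr (z : C) : Cmod z ^ 2 = Re z ^ 2 + Im z ^ 2.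
Proof. unfold Cmod. rewrite pow2_sqrt; [easy|]. generalize (pow2_ge_0 (fst z)) (pow2_ge_0 (snd z)). lra. Qed.

(** This compares the derivative of the energy [|d|^2 + |d'|^2] with the energy itself,
    given [|d''|^2 <= b |d|^2]. *)
Lemma energy_bound (p q p1 q1 p2 q2 b : R) :
  0 <= b -> p2 ^ 2 + q2 ^ 2 <= b * (p ^ 2 + q ^ 2) ->
  ((p1 * p + p * p1) + (q1 * q + q * q1)) + ((p2 * p1 + p1 * p2) + (q2 * q1 + q1 * q2))
  <= (2 + b) * ((p * p + q * q) + (p1 * p1 + q1 * q1)).
Proof.
  intros Hb H.
  assert (0 <= b * (p1 * p1 + q1 * q1)) by (apply Rmult_le_pos; nra).
  assert (A1 := pow2_ge_0 (p - p1)). assert (A2 := pow2_ge_0 (q - q1)).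
  assert (A3 := pow2_ge_0 (p1 - p2)). assert (A4 := pow2_ge_0 (q1 - q2)).
  assert (A5 := pow2_ge_0 p). assert (A6 := pow2_ge_0 q). lra.
Qed.

(** Gronwall's argument for the energy [|d|^2 + |d'|^2]. *)
Lemma second_order_zero (d d1 d2 : R -> C) (B b : R) :
  (forall t, 0 <= t < b -> derivable_C d t (d1 t) /\ derivable_C d1 t (d2 t)) ->
  (forall t, 0 < t < b -> Cmod (d2 t) <= B * Cmod (d t)) ->
  d 0 = 0 -> d1 0 = 0 -> forall t, 0 <= t < b -> d t = 0.
Proof.
  intros HD HB H0 H1 t Ht.
  set (E := fun s => (Re (d s) * Re (d s) + Im (d s) * Im (d s))
                     + (Re (d1 s) * Re (d1 s) + Im (d1 s) * Im (d1 s))).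
  set (E' := fun s => ((Re (d1 s) * Re (d s) + Re (d s) * Re (d1 s))
       + (Im (d1 s) * Im (d s) + Im (d s) * Im (d1 s)))
     + ((Re (d2 s) * Re (d1 s) + Re (d1 s) * Re (d2 s))
       + (Im (d2 s) * Im (d1 s) + Im (d1 s) * Im (d2 s)))).
  assert (L : E t <= 0).
  { apply (gronwall_zero E E' (2 + B ^ 2) b); [| | |easy].
    - intros s Hs. destruct (HD s Hs) as [[A1 A2] [A3 A4]].
      unfold E, E'.
      apply is_derive_Rplus; apply is_derive_Rplus; apply is_derive_Rmult; assumption.
    - intros s Hs. assert (A := HB s Hs).
      assert (A2 : Cmod (d2 s) ^ 2 <= B ^ 2 * Cmod (d s) ^ 2).
      { rewrite <- Rpow_mult_distr. apply pow_incr. split; [apply Cmod_ge_0|easy]. }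
      rewrite !Cmod_sqr in A2. unfold E', E.
      apply energy_bound; [apply pow2_ge_0|exact A2].
    - unfold E. rewrite H0, H1. simpl. ring. }
  unfold E in L.
  apply injective_projections; change (fst (d t)) with (Re (d t));
    change (snd (d t)) with (Im (d t)); simpl; nra.
Qed.

Lemma left_limit_zero (f : R -> R) (a delta : R) :
  0 < delta -> continuous f a -> (forall h, - delta < h < 0 -> f (a + h) = 0) ->
  f a = 0.
Proof.
  intros Hd Hc H. destruct (Req_dec (f a) 0) as [E|Hne]; [easy|exfalso].
  assert (He : 0 < Rabs (f a)) by now apply Rabs_pos_lt.
  destruct (proj1 (filterlim_locally _ _) Hc (mkposreal _ He)) as [e Hball].
  set (h := - (Rmin delta e / 2)).
  assert (Hm : 0 < Rmin delta e) by (apply Rmin_glb_lt; [easy|apply cond_pos]).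
  assert (Hm1 := Rmin_l delta e). assert (Hm2 := Rmin_r delta e).
  assert (Hb : ball a e (a + h)).
  { change (Rabs (a + h - a) < e). replace (a + h - a) with h by ring.
    unfold h. rewrite Rabs_Ropp, Rabs_right; lra. }
  specialize (Hball _ Hb). rewrite H in Hball by (unfold h; lra).
  change (Rabs (0 - f a) < Rabs (f a)) in Hball.
  rewrite Rminus_0_l, Rabs_Ropp in Hball. lra.
Qed.

Lemma left_derivative_zero (f : R -> R) (l delta : R) :
  0 < delta -> is_derive f 0 l -> (forall h, - delta < h < 0 -> f h = 0) ->
  f 0 = 0 /\ l = 0.
Proof.
  intros Hd HD H.
  assert (E0 : f 0 = 0).
  { apply (left_limit_zero f 0 delta Hd).
    - apply (ex_derive_continuous (K := R_AbsRing) (V := R_NormedModule)). now exists l.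
    - intros h Hh. rewrite Rplus_0_l. auto. }
  split; [easy|].
  destruct (Req_dec l 0) as [E|Hne]; [easy|exfalso].
  apply is_derive_Reals in HD.
  assert (He : 0 < Rabs l) by now apply Rabs_pos_lt.
  destruct (HD (Rabs l) He) as [e Hq].
  set (h := - (Rmin delta e / 2)).
  assert (Hm : 0 < Rmin delta e) by (apply Rmin_glb_lt; [easy|apply cond_pos]).
  assert (Hm1 := Rmin_l delta e). assert (Hm2 := Rmin_r delta e).
  assert (Hh : - delta < h < 0) by (unfold h; lra).
  assert (Hh2 : Rabs h < e) by (unfold h; rewrite Rabs_Ropp, Rabs_right; lra).
  specialize (Hq h ltac:(lra) Hh2).
  rewrite Rplus_0_l, (H h Hh), E0 in Hq.
  replace ((0 - 0) / h - l) with (- l) in Hq by (field; lra).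
  rewrite Rabs_Ropp in Hq. lra.
Qed.

Lemma left_derivative_zero_C (f : R -> C) (l : C) (delta : R) :
  0 < delta -> derivable_C f 0 l -> (forall h, - delta < h < 0 -> f h = 0) ->
  f 0 = 0 /\ l = 0.
Proof.
  intros Hd [H1 H2] H.
  destruct (left_derivative_zero _ _ delta Hd H1) as [A1 A2].
  { intros h Hh. rewrite H; easy. }
  destruct (left_derivative_zero _ _ delta Hd H2) as [B1 B2].
  { intros h Hh. rewrite H; easy. }
  split; apply injective_projections; easy.
Qed.

(** A function with nonzero first-order jet at 0 has no zeros accumulating at 0. *)
Lemma nonzero_after (f : R -> C) (l : C) :
  derivable_C f 0 l -> f 0 <> 0 \/ l <> 0 ->
  exists delta, 0 < delta /\ forall h, 0 < h < delta -> f h <> 0.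
Proof.
  intros HD Hne.
  destruct (Ceq_dec (f 0) 0) as [E0|N0].
  - destruct Hne as [Hne|Hne]; [easy|].
    assert (K : forall (g : R -> R) (m : R), is_derive g 0 m -> g 0 = 0 -> m <> 0 ->
       exists delta, 0 < delta /\ forall h, 0 < h < delta -> g h <> 0).
    { intros g m Hg Hg0 Hm. apply is_derive_Reals in Hg.
      destruct (Hg (Rabs m) (Rabs_pos_lt m Hm)) as [e He].
      exists e. split; [apply cond_pos|]. intros h Hh Eh.
      specialize (He h ltac:(lra) ltac:(rewrite Rabs_right; lra)).
      rewrite Rplus_0_l, Eh, Hg0 in He.
      replace ((0 - 0) / h - m) with (- m) in He by (field; lra).
      rewrite Rabs_Ropp in He. lra. }
    destruct HD as [D1 D2].
    destruct (Req_dec (Re l) 0) as [Er|Nr].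
    + assert (Ni : Im l <> 0) by (intro Ei; apply Hne; now apply injective_projections).
      destruct (K _ _ D2 (f_equal Im E0) Ni) as [del [Hdel Hh]].
      exists del. split; [easy|]. intros h H E. apply (Hh h H). now rewrite E.
    + destruct (K _ _ D1 (f_equal Re E0) Nr) as [del [Hdel Hh]].
      exists del. split; [easy|]. intros h H E. apply (Hh h H). now rewrite E.
  - destruct (derivable_C_nonzero f 0 l HD N0) as [e He].
    exists e. split; [apply cond_pos|]. intros h Hh. apply He.
    change (Rabs (h - 0) < e). rewrite Rminus_0_r, Rabs_right; lra.
Qed.

Lemma real_induction (P : R -> Prop) :
  (forall t0, 0 <= t0 -> (forall t, 0 <= t < t0 -> P t) ->
     exists e, 0 < e /\ forall t, t0 <= t < t0 + e -> P t) ->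
  forall t, 0 <= t -> P t.
Proof.
  intros Hstep t1 Ht1. apply Classical_Prop.NNPP. intro Hn.
  set (A := fun s => 0 <= s /\ forall t, 0 <= t < s -> P t).
  assert (Hb : is_upper_bound A t1).
  { intros s [Hs1 Hs2]. apply Rnot_lt_le. intro. apply Hn, Hs2. lra. }
  assert (H0 : A 0) by (split; [lra|]; intros; lra).
  destruct (completeness A ltac:(now exists t1) ltac:(now exists 0)) as [m [Hm1 Hm2]].
  assert (Hm0 : 0 <= m) by now apply Hm1.
  assert (Hbelow : forall t, 0 <= t < m -> P t).
  { intros t Ht. apply Classical_Prop.NNPP. intro Hnt.
    assert (m <= t); [|lra]. apply Hm2. intros s [Hs1 Hs2].
    apply Rnot_lt_le. intro. apply Hnt, Hs2. lra. }
  destruct (Hstep m Hm0 Hbelow) as [e [He Hnext]].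
  assert (A (m + e)).
  { split; [lra|]. intros t Ht. destruct (Rlt_le_dec t m); [apply Hbelow|apply Hnext]; lra. }
  generalize (Hm1 _ H). lra.
Qed.

(** Differentiating [u'^2 = 4 u - (16/27) u^3] gives
    [2 u' u'' = (4 - (16/9) u^2) u'], and [u'] can be cancelled. *)
Lemma first_integral_to_second_order (u u1 : R -> C) (l2 : C) (h : R) :
  locally h (fun s => derivable_C u s (u1 s) /\
     (u1 s ^ 2 = 4 * u s - 16 / 27 * u s ^ 3)%C) ->
  derivable_C u1 h l2 -> u1 h <> 0 ->
  (l2 = 2 - 8 / 9 * u h ^ 2)%C.
Proof.
  intros Hloc HD2 Hne.
  assert (HD1 := proj1 (locally_singleton _ _ Hloc)).
  assert (A1 := derivable_C_mult _ _ _ _ _ HD2 HD2).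
  assert (A2 : derivable_C (fun s => (u1 s * u1 s)%C) h
     (4 * u1 h - 16 / 27 * (u1 h * (u h * u h) + u h * (u1 h * u h + u h * u1 h)))%C).
  { apply (derivable_C_ext_loc (fun s => (4 * u s - 16 / 27 * (u s * (u s * u s)))%C)).
    - revert Hloc. apply filter_imp. intros s [_ Hs].
      replace (u1 s * u1 s)%C with (u1 s ^ 2)%C by ring. rewrite Hs. ring.
    - apply derivable_C_minus.
      + replace (4 * u1 h)%C with (0 * u h + 4 * u1 h)%C by ring.
        apply (derivable_C_mult (fun _ => RtoC 4)); [apply derivable_C_const|easy].
      + replace (16 / 27 * (u1 h * (u h * u h) + u h * (u1 h * u h + u h * u1 h)))%C
          with (0 * (u h * (u h * u h))
           + 16 / 27 * (u1 h * (u h * u h) + u h * (u1 h * u h + u h * u1 h)))%C by ring.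
        apply (derivable_C_mult (fun _ => (16 / 27)%C)); [apply derivable_C_const|].
        apply derivable_C_mult; [easy|]. apply derivable_C_mult; easy. }
  assert (A := derivable_C_unique _ _ _ _ A1 A2).
  assert (B : (2 * u1 h * (l2 - (2 - 8 / 9 * u h ^ 2)) = 0)%C).
  { replace (2 * u1 h * (l2 - (2 - 8 / 9 * u h ^ 2)))%C
      with (l2 * u1 h + u1 h * l2 - 2 * u1 h * (2 - 8 / 9 * u h ^ 2))%C by ring.
    rewrite A. field. }
  destruct (Ceq_dec (l2 - (2 - 8 / 9 * u h ^ 2))%C 0) as [Z|NZ].
  - replace l2 with (l2 - (2 - 8 / 9 * u h ^ 2) + (2 - 8 / 9 * u h ^ 2))%C by ring.
    rewrite Z. ring.
  - exfalso. revert B. apply Cmult_neq_0; [|easy].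
    apply Cmult_neq_0; [|easy]. intro E. apply RtoC_inj in E. lra.
Qed.

(** The second-order equation is known only where [u'] does not vanish, but a nonzero
    first-order jet of [u'] at 0 keeps it away from 0 just after 0.  There the difference
    [d = u - v] satisfies [d'' = - (8/9) (u + v) d]. *)
Lemma local_uniqueness (u u1 u2 v v1 v2 : R -> C) (delta : R) :
  0 < delta ->
  (forall h, Rabs h < delta -> derivable_C u h (u1 h) /\ derivable_C u1 h (u2 h)) ->
  (forall h, Rabs h < delta -> derivable_C v h (v1 h) /\ derivable_C v1 h (v2 h)) ->
  (forall h, 0 < h < delta -> (u1 h ^ 2 = 4 * u h - 16 / 27 * u h ^ 3)%C) ->
  (forall h, Rabs h < delta -> (v2 h = 2 - 8 / 9 * v h ^ 2)%C) ->
  u 0 = v 0 -> u1 0 = v1 0 -> u1 0 <> 0 \/ u2 0 <> 0 ->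
  exists e, 0 < e <= delta /\ forall h, 0 <= h < e -> u h = v h.
Proof.
  intros Hd Hu Hv Hode Hv2 E0 E1 Hne.
  assert (R0 : Rabs 0 < delta) by now rewrite Rabs_R0.
  destruct (nonzero_after u1 (u2 0) (proj2 (Hu 0 R0)) Hne) as [r [Hr Hnz]].
  destruct (derivable_C_continuous _ _ _ (proj1 (Hu 0 R0)) 1 Rlt_0_1) as [eu Heu].
  destruct (derivable_C_continuous _ _ _ (proj1 (Hv 0 R0)) 1 Rlt_0_1) as [ev Hev].
  set (e := Rmin (Rmin delta r) (Rmin eu ev)).
  assert (He : 0 < e).
  { unfold e. repeat apply Rmin_glb_lt; try easy; apply cond_pos. }
  assert (L1 : e <= delta) by (unfold e; eapply Rle_trans; [apply Rmin_l|apply Rmin_l]).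
  assert (L2 : e <= r) by (unfold e; eapply Rle_trans; [apply Rmin_l|apply Rmin_r]).
  assert (L3 : e <= eu) by (unfold e; eapply Rle_trans; [apply Rmin_r|apply Rmin_l]).
  assert (L4 : e <= ev) by (unfold e; eapply Rle_trans; [apply Rmin_r|apply Rmin_r]).
  exists e. split; [easy|].
  assert (Habs : forall h, 0 <= h < e -> Rabs h < e) by (intros; rewrite Rabs_right; lra).
  set (B := 8 / 9 * (Cmod (u 0) + 1 + (Cmod (v 0) + 1))).
  assert (Hz : forall t, 0 <= t < e -> (u t - v t)%C = 0).
  { apply (second_order_zero (fun s => (u s - v s)%C) (fun s => (u1 s - v1 s)%C)
      (fun s => (u2 s - v2 s)%C) B e).
    - intros t Ht. assert (Ha := Habs t Ht).
      destruct (Hu t ltac:(lra)) as [U1 U2]. destruct (Hv t ltac:(lra)) as [V1 V2].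
      split; now apply derivable_C_minus.
    - intros t Ht. assert (Ha := Habs t ltac:(lra)).
      assert (U2 : (u2 t = 2 - 8 / 9 * u t ^ 2)%C).
      { apply (first_integral_to_second_order u u1 (u2 t) t).
        - assert (Hp : 0 < Rmin t (e - t)) by (apply Rmin_glb_lt; lra).
          exists (mkposreal _ Hp). intros s Hs. change (Rabs (s - t) < Rmin t (e - t)) in Hs.
          assert (M1 := Rmin_l t (e - t)). assert (M2 := Rmin_r t (e - t)).
          apply Rabs_def2 in Hs.
          split; [apply Hu; rewrite Rabs_right; lra|apply Hode; lra].
        - apply Hu; lra.
        - apply Hnz; lra. }
      rewrite U2, Hv2 by lra.
      replace (2 - 8 / 9 * u t ^ 2 - (2 - 8 / 9 * v t ^ 2))%C
        with (- (8 / 9 * (u t + v t)) * (u t - v t))%C by ring.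
      rewrite Cmod_mult. apply Rmult_le_compat_r; [apply Cmod_ge_0|].
      rewrite Cmod_opp, Cmod_mult.
      replace (8 / 9)%C with (RtoC (8 / 9)) by (now rewrite RtoC_div).
      rewrite Cmod_R, Rabs_right by lra.
      apply Rmult_le_compat_l; [lra|].
      eapply Rle_trans; [apply Cmod_triangle|].
      assert (Bu : Cmod (u t - u 0) < 1).
      { apply Heu. change (Rabs (t - 0) < eu). rewrite Rminus_0_r. lra. }
      assert (Bv : Cmod (v t - v 0) < 1).
      { apply Hev. change (Rabs (t - 0) < ev). rewrite Rminus_0_r. lra. }
      generalize (Cmod_triangle (u t - u 0) (u 0)) (Cmod_triangle (v t - v 0) (v 0)).
      replace (u t - u 0 + u 0)%C with (u t) by ring.
      replace (v t - v 0 + v 0)%C with (v t) by ring. lra.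
    - rewrite E0. ring.
    - rewrite E1. ring. }
  intros h Hh. replace (u h) with (u h - v h + v h)%C by ring.
  rewrite Hz by easy. ring.
Qed.

(** * The Weierstrass function as an inverse lemniscate square *)

(** [S1] is the derivative of [S]; this is the equation of the lemniscate sine, up to a
    scaling of [S] and of time. *)
Definition lemniscatic (S S1 : R -> R) : Prop :=
  forall t, is_derive S t (S1 t) /\ is_derive S1 t (- (8 / 27) * S t ^ 3) /\
    S1 t ^ 2 + 4 / 27 * S t ^ 4 = 1.

Definition twice_derivable_C (f f1 f2 : R -> C) (h : R) : Prop :=
  derivable_C f h (f1 h) /\ derivable_C f1 h (f2 h).

Lemma twice_derivable_inv (f f1 f2 : R -> C) (delta : R) :
  (forall h, Rabs h < delta -> f h <> 0 /\ twice_derivable_C f f1 f2 h) ->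
  forall h, Rabs h < delta ->
  twice_derivable_C (fun s => / f s)%C (fun s => - (f1 s * (/ f s * / f s)))%C
    (fun s => - (f2 s * (/ f s * / f s) +
        f1 s * (- (f1 s * (/ f s * / f s)) * / f s
                + / f s * - (f1 s * (/ f s * / f s)))))%C h.
Proof.
  intros H h Hh. destruct (H h Hh) as [Hne [D1 D2]].
  assert (DI : derivable_C (fun s => / f s)%C h (- (f1 h * (/ f h * / f h)))%C).
  { replace (/ f h * / f h)%C with ((/ f h) ^ 2)%C by ring.
    now apply derivable_C_inv. }
  split; [exact DI|].
  apply derivable_C_opp. apply derivable_C_mult; [easy|].
  now apply derivable_C_mult.
Qed.

Lemma twice_derivable_sqr_mult (f f1 f2 : R -> C) (h : R) :
  twice_derivable_C f f1 f2 h ->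
  twice_derivable_C (fun s => RtoC (s * s) * f s)%C
    (fun s => RtoC (2 * s) * f s + RtoC (s * s) * f1 s)%C
    (fun s => RtoC 2 * f s + RtoC (2 * s) * f1 s
              + (RtoC (2 * s) * f1 s + RtoC (s * s) * f2 s))%C h.
Proof.
  intros [D1 D2].
  assert (A : derivable_C (fun s => RtoC (s * s)) h (RtoC (2 * h))).
  { apply derivable_C_RtoC. auto_derive; [easy|ring]. }
  assert (B : derivable_C (fun s => RtoC (2 * s)) h (RtoC 2)).
  { apply derivable_C_RtoC. auto_derive; [easy|ring]. }
  split.
  - now apply (derivable_C_mult (fun s => RtoC (s * s))).
  - apply derivable_C_plus.
    + now apply (derivable_C_mult (fun s => RtoC (2 * s))).
    + now apply (derivable_C_mult (fun s => RtoC (s * s))).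
Qed.

Lemma is_derive_shift (f : R -> R) (a h l : R) :
  is_derive f (a + h) l -> is_derive (fun s => f (a + s)) h l.
Proof.
  intro H. replace l with (1 * l) by ring.
  apply (is_derive_comp f (fun s => a + s) h l 1 H).
  auto_derive; [easy|ring].
Qed.

Lemma derivable_C_shift (f : R -> C) (a h : R) (l : C) :
  derivable_C f (a + h) l -> derivable_C (fun s => f (a + s)) h l.
Proof.
  intros [H1 H2]. split.
  - now apply (is_derive_shift (fun s => Re (f s))).
  - now apply (is_derive_shift (fun s => Im (f s))).
Qed.

Lemma lemniscatic_sqr_derivatives (S S1 : R -> R) (a h : R) :
  lemniscatic S S1 ->
  twice_derivable_C (fun s => RtoC (S (a + s) ^ 2))
    (fun s => RtoC (2 * (S (a + s) * S1 (a + s))))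
    (fun s => RtoC (2 - 8 / 9 * S (a + s) ^ 4)) h.
Proof.
  intro HS. destruct (HS (a + h)) as [D1 [D2 E]].
  apply is_derive_shift in D1, D2.
  split; apply derivable_C_RtoC.
  - apply (is_derive_ext (fun s => S (a + s) * S (a + s))); [intro s; simpl; ring|].
    replace (2 * (S (a + h) * S1 (a + h)))
      with (S1 (a + h) * S (a + h) + S (a + h) * S1 (a + h)) by ring.
    now apply (is_derive_Rmult (fun s => S (a + s)) (fun s => S (a + s))).
  - replace (2 - 8 / 9 * S (a + h) ^ 4)
      with (0 * (S (a + h) * S1 (a + h)) + 2 *
        (S1 (a + h) * S1 (a + h) + S (a + h) * (- (8 / 27) * S (a + h) ^ 3)))
      by lra.
    apply (is_derive_Rmult (fun _ => 2) (fun s => S (a + s) * S1 (a + s))).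
    + apply (is_derive_const (K := R_AbsRing) (V := R_NormedModule)).
    + now apply (is_derive_Rmult (fun s => S (a + s)) (fun s => S1 (a + s))).
Qed.

(** For [u = 1 / wp] one has [wp' = - u' / u^2]; multiplying the equation of [wp] by
    [u^4] clears the denominators. *)
Lemma wp_inverse_first_integral (w1 w2 : C) (u : R -> C) (t : R) (l : C) :
  wp_satisfies_ode w1 w2 (RtoC (16 / 27)) (RtoC 0) ->
  ~ in_lattice w1 w2 (RtoC t) ->
  locally t (fun s => (wp w1 w2 (RtoC s) * u s)%C = 1) ->
  derivable_C u t l -> (l ^ 2 = 4 * u t - 16 / 27 * u t ^ 3)%C.
Proof.
  intros hwp Hl Hloc HD.
  assert (N1 : forall s, (wp w1 w2 (RtoC s) * u s)%C = 1 -> u s <> 0).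
  { intros s E E0. rewrite E0, Cmult_0_r in E. apply RtoC_inj in E. lra. }
  assert (EW : forall s, (wp w1 w2 (RtoC s) * u s)%C = 1 ->
                 (/ u s)%C = wp w1 w2 (RtoC s)).
  { intros s E. assert (N := N1 s E).
    replace (wp w1 w2 (RtoC s)) with (wp w1 w2 (RtoC s) * u s * / u s)%C
      by (field; easy). rewrite E. field. easy. }
  assert (Et := locally_singleton _ _ Hloc). assert (Nt := N1 t Et).
  assert (D : derivable_C (fun s => wp w1 w2 (RtoC s)) t (- (l * (/ u t) ^ 2))%C).
  { apply (derivable_C_ext_loc (fun s => (/ u s)%C)).
    - revert Hloc. apply filter_imp. intros s E. now apply EW.
    - now apply derivable_C_inv. }
  assert (E := hwp _ Hl). unfold wp' in E. rewrite (C_derive_real _ _ _ D) in E.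
  rewrite <- (EW t Et) in E.
  transitivity ((- (l * (/ u t) ^ 2)) ^ 2 * u t ^ 4)%C; [field; easy|].
  rewrite E. rewrite RtoC_div by lra. field. easy.
Qed.

(** The pole of [wp] corresponds to the zero of [S]; in this form the identity
    [wp = 1 / S^2] also makes sense at the lattice points. *)
Definition wp_matches (w1 w2 : C) (S : R -> R) (t : R) : Prop :=
  (in_lattice w1 w2 (RtoC t) -> S t = 0) /\
  (~ in_lattice w1 w2 (RtoC t) -> (wp w1 w2 (RtoC t) * RtoC (S t ^ 2))%C = 1).

(** Both [1 / wp] and [S^2] solve [u'^2 = 4 u - (16/27) u^3], so agreement of their jets
    at [t0] propagates to the right. *)
Lemma inverse_wp_after (w1 w2 : C) (S S1 : R -> R) (t0 delta : R) (u u1 u2 : R -> C) :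
  wp_satisfies_ode w1 w2 (RtoC (16 / 27)) (RtoC 0) ->
  lemniscatic S S1 -> 0 < delta ->
  (forall h, Rabs h < delta -> twice_derivable_C u u1 u2 h) ->
  (forall h, 0 < h < delta -> ~ in_lattice w1 w2 (RtoC (t0 + h)) /\
     (wp w1 w2 (RtoC (t0 + h)) * u h)%C = 1) ->
  u 0 = RtoC (S t0 ^ 2) -> u1 0 = RtoC (2 * (S t0 * S1 t0)) ->
  u1 0 <> 0 \/ u2 0 <> 0 ->
  exists e, 0 < e <= delta /\
    forall h, 0 <= h < e -> u h = RtoC (S (t0 + h) ^ 2).
Proof.
  intros hwp HS Hd HU Hwu J0 J1 Hne.
  apply (local_uniqueness u u1 u2 _ (fun s => RtoC (2 * (S (t0 + s) * S1 (t0 + s))))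
    (fun s => RtoC (2 - 8 / 9 * S (t0 + s) ^ 4)) delta Hd HU).
  - intros h _. now apply lemniscatic_sqr_derivatives.
  - intros h Hh.
    destruct (Hwu h Hh) as [A B].
    assert (W := wp_inverse_first_integral w1 w2 (fun s => u (- t0 + s)) (t0 + h)).
    cbv beta in W. replace (- t0 + (t0 + h)) with h in W by ring.
    apply W; clear W; [easy|easy| |].
    + assert (Hp : 0 < Rmin h (delta - h)) by (apply Rmin_glb_lt; lra).
      exists (mkposreal _ Hp). intros s Hs. change R in s.
      change (Rabs (s - (t0 + h)) < Rmin h (delta - h)) in Hs.
      assert (M1 := Rmin_l h (delta - h)). assert (M2 := Rmin_r h (delta - h)).
      apply Rabs_def2 in Hs.
      destruct (Hwu (- t0 + s)) as [_ E]; [lra|].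
      now replace (t0 + (- t0 + s)) with s in E by ring.
    + apply derivable_C_shift. replace (- t0 + (t0 + h)) with h by ring.
      apply HU. rewrite Rabs_right; lra.
  - intros h _. cbv beta. rewrite <- RtoC_pow, RtoC_minus, RtoC_mult, RtoC_div by lra.
    now replace ((S (t0 + h) ^ 2) ^ 2) with (S (t0 + h) ^ 4) by ring.
  - now rewrite Rplus_0_r.
  - now rewrite Rplus_0_r.
  - exact Hne.
Qed.

(** At a pole the jet of [1 / wp] is [(0, 0, 2)].  The only thing taken from the left of
    [t0] is [S t0 = 0], which then gives [S^2] the same jet. *)
Lemma wp_matches_after_pole (w1 w2 : C) (S S1 : R -> R) (t0 : R) :
  is_lattice_basis w1 w2 ->
  wp_satisfies_ode w1 w2 (RtoC (16 / 27)) (RtoC 0) ->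
  lemniscatic S S1 -> S 0 = 0 -> 0 <= t0 -> in_lattice w1 w2 (RtoC t0) ->
  (forall t, 0 <= t < t0 -> wp_matches w1 w2 S t) ->
  exists e, 0 < e /\ forall t, t0 <= t < t0 + e -> wp_matches w1 w2 S t.
Proof.
  intros hw hwp HS HS0 Ht0 Hin Hbelow.
  destruct (wp_local w1 w2 (RtoC t0) hw)
    as [d [eps [g [g1 [g2 [Hd [[[_ ->]|[Hout _]] [Hg Hwp]]]]]]]]; [|easy].
  set (E := fun s => (1 + RtoC (s * s) * g s)%C).
  set (E1 := fun s => (RtoC (2 * s) * g s + RtoC (s * s) * g1 s)%C).
  set (E2 := fun s => (RtoC 2 * g s + RtoC (2 * s) * g1 s
            + (RtoC (2 * s) * g1 s + RtoC (s * s) * g2 s))%C).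
  assert (HE : forall h, Rabs h < d -> twice_derivable_C E E1 E2 h).
  { intros h Hh. destruct (twice_derivable_sqr_mult g g1 g2 h (Hg h Hh)) as [A B].
    split; [|exact B].
    replace (E1 h) with (0 + E1 h)%C by ring.
    apply (derivable_C_plus (fun _ => RtoC 1)); [apply derivable_C_const|exact A]. }
  assert (R0 : Rabs 0 < d) by now rewrite Rabs_R0.
  assert (E00 : E 0 = 1).
  { unfold E. replace (0 * 0) with 0 by ring. ring. }
  assert (NE0 : E 0 <> 0) by (rewrite E00; intro A; apply RtoC_inj in A; lra).
  destruct (derivable_C_nonzero E 0 _ (proj1 (HE 0 R0)) NE0) as [r Hr].
  set (d' := Rmin d r).
  assert (Hd' : 0 < d') by (apply Rmin_glb_lt; [easy|apply cond_pos]).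
  assert (Ld : d' <= d) by apply Rmin_l. assert (Lr : d' <= r) by apply Rmin_r.
  assert (NE : forall h, Rabs h < d' -> E h <> 0 /\ twice_derivable_C E E1 E2 h).
  { intros h Hh. split; [|apply HE; lra]. apply Hr.
    change (Rabs (h - 0) < r). rewrite Rminus_0_r. lra. }
  (* The reciprocal of 1/h^2 + g is h^2 / (1 + h^2 g), regular at the pole. *)
  assert (HW := twice_derivable_inv E E1 E2 d' NE).
  assert (HU := fun h Hh => twice_derivable_sqr_mult _ _ _ h (HW h Hh)).
  set (u := fun s => (RtoC (s * s) * / E s)%C).
  assert (Hwu : forall h, Rabs h < d' -> h <> 0 ->
     ~ in_lattice w1 w2 (RtoC (t0 + h)) /\ (wp w1 w2 (RtoC (t0 + h)) * u h)%C = 1).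
  { intros h Hh Hne. destruct (Hwp h ltac:(lra) (or_introl Hne)) as [A B].
    rewrite RtoC_plus. split; [exact A|].
    rewrite B. unfold u, E. rewrite !RtoC_mult.
    assert (RtoC h <> 0) by (intro K; apply RtoC_inj in K; easy).
    destruct (NE h Hh) as [N _]. unfold E in N. rewrite RtoC_mult in N.
    field. now split. }
  assert (HS00 : S t0 = 0).
  { destruct (Req_dec t0 0) as [->|Hne]; [easy|].
    (* On the left S^2 (1 + h^2 g) = h^2; both sides are continuous at h = 0. *)
    assert (K : S t0 ^ 2 * (1 + 0 * 0 * Re (g 0)) - 0 * 0 = 0).
    { replace t0 with (t0 + 0) at 1 by ring.
      apply (left_limit_zero
        (fun s => S (t0 + s) ^ 2 * (1 + s * s * Re (g s)) - s * s) 0 (Rmin d' t0)).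
      - apply Rmin_glb_lt; lra.
      - apply (ex_derive_continuous (K := R_AbsRing) (V := R_NormedModule)).
        destruct (proj1 (Hg 0 R0)) as [G _].
        destruct (proj1 (lemniscatic_sqr_derivatives S S1 t0 0 HS)) as [V _].
        simpl in V. eexists. apply is_derive_Rminus.
        + apply is_derive_Rmult; [exact V|].
          apply is_derive_Rplus;
            [apply (is_derive_const (K := R_AbsRing) (V := R_NormedModule))|].
          apply is_derive_Rmult; [|exact G].
          apply is_derive_Rmult; apply (is_derive_id (K := R_AbsRing)).
        + apply is_derive_Rmult; apply (is_derive_id (K := R_AbsRing)).
      - intros h Hh. rewrite Rplus_0_l.
        assert (M1 := Rmin_l d' t0). assert (M2 := Rmin_r d' t0).
        assert (Ha : Rabs h < d') by (rewrite Rabs_left; lra).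
        destruct (Hwu h Ha ltac:(lra)) as [A B].
        destruct (Hbelow (t0 + h) ltac:(lra)) as [_ M]. specialize (M A).
        set (v := RtoC (S (t0 + h) ^ 2)) in M.
        assert (P : (v * E h = RtoC (h * h))%C).
        { destruct (NE h Ha) as [N _]. unfold u in B.
          transitivity (v
            * (wp w1 w2 (RtoC (t0 + h)) * (RtoC (h * h) * / E h)) * E h)%C.
          - rewrite B. ring.
          - transitivity ((wp w1 w2 (RtoC (t0 + h)) * v) * RtoC (h * h))%C;
              [field; easy|]. rewrite M. ring. }
        apply (f_equal Re) in P. unfold v, E in P.
        rewrite re_scal_l, re_plus, re_scal_l in P.
        change (Re (RtoC (h * h))) with (h * h) in P. change (Re 1) with 1 in P. lra. }
    assert (K2 : S t0 ^ 2 = 0) by lra. nra. }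
  destruct (inverse_wp_after w1 w2 S S1 t0 d' u _ _ hwp HS Hd' HU) as [e [He Hu]].
  - intros h Hh. apply Hwu; [rewrite Rabs_right|]; lra.
  - unfold u. rewrite HS00.
    replace (0 * 0) with 0 by ring. replace (0 ^ 2) with 0 by ring. ring.
  - rewrite HS00.
    replace (0 * 0) with 0 by ring. replace (2 * (0 * S1 t0)) with 0 by ring.
    replace (2 * 0) with 0 by ring. ring.
  - right. replace (0 * 0) with 0 by ring. replace (2 * 0) with 0 by ring.
    rewrite E00. intro A. apply (f_equal Re) in A.
    replace (2 * / 1)%C with (RtoC 2) in A
      by (field; intro K; apply RtoC_inj in K; lra).
    rewrite !re_plus, !re_scal_l in A. change (Re (RtoC 2)) with 2 in A.
    change (Re (RtoC 0)) with 0 in A. lra.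
  - exists e. split; [easy|]. intros t Ht.
    destruct (Req_dec t t0) as [->|Hne].
    + split; [easy|]. intro N. now elim N.
    + assert (Ha : Rabs (t - t0) < d') by (rewrite Rabs_right; lra).
      destruct (Hwu (t - t0) Ha ltac:(lra)) as [A B].
      rewrite (Hu (t - t0)) in B by lra.
      replace (t0 + (t - t0)) with t in * by ring.
      split; [intro; easy|easy].
Qed.

(** By continuity [wp * S^2 = 1] holds at [t0] too, so neither factor vanishes there.  The
    first two derivatives of [S^2] do not both vanish at such a point. *)
Lemma wp_matches_after_regular (w1 w2 : C) (S S1 : R -> R) (t0 : R) :
  is_lattice_basis w1 w2 ->
  wp_satisfies_ode w1 w2 (RtoC (16 / 27)) (RtoC 0) ->
  lemniscatic S S1 -> 0 <= t0 -> ~ in_lattice w1 w2 (RtoC t0) ->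
  (forall t, 0 <= t < t0 -> wp_matches w1 w2 S t) ->
  exists e, 0 < e /\ forall t, t0 <= t < t0 + e -> wp_matches w1 w2 S t.
Proof.
  intros hw hwp HS Ht0 Hout Hbelow.
  destruct (wp_local w1 w2 (RtoC t0) hw)
    as [d [eps [g [g1 [g2 [Hd [[[Hin _]|[_ ->]] [Hg Hwp]]]]]]]]; [easy|].
  set (v := fun s => RtoC (S (t0 + s) ^ 2)).
  set (v1 := fun s => RtoC (2 * (S (t0 + s) * S1 (t0 + s)))).
  set (v2 := fun s => RtoC (2 - 8 / 9 * S (t0 + s) ^ 4)).
  assert (Hv : forall h, twice_derivable_C v v1 v2 h)
    by (intro h; now apply lemniscatic_sqr_derivatives).
  (* 0 is a lattice point, so there is room on the left of t0. *)
  assert (Hpos : 0 < t0).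
  { destruct (Req_dec t0 0) as [->|Hne]; [|lra].
    exfalso. apply Hout. exists 0%Z, 0%Z. unfold lattice_pt. ring. }
  assert (R0 : Rabs 0 < d) by now rewrite Rabs_R0.
  assert (Hwg : forall h, Rabs h < d -> ~ in_lattice w1 w2 (RtoC (t0 + h)) /\
             wp w1 w2 (RtoC (t0 + h)) = g h).
  { intros h Hh. destruct (Hwp h Hh (or_intror Hout)) as [A B].
    rewrite RtoC_plus. split; [easy|]. rewrite B. ring. }
  assert (Hleft : forall h, - Rmin d t0 < h < 0 -> (g h * v h)%C = 1).
  { intros h Hh. assert (M1 := Rmin_l d t0). assert (M2 := Rmin_r d t0).
    destruct (Hwg h ltac:(rewrite Rabs_left; lra)) as [A B].
    destruct (Hbelow (t0 + h) ltac:(lra)) as [_ M]. specialize (M A).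
    now rewrite B in M. }
  assert (Hm : 0 < Rmin d t0) by (apply Rmin_glb_lt; lra).
  assert (G0 : (g 0 * v 0 - 1)%C = 0).
  { destruct (left_derivative_zero_C (fun s => g s * v s - 1)%C
      (g1 0 * v 0 + g 0 * v1 0 - 0)%C (Rmin d t0) Hm) as [A _]; [| |exact A].
    - apply derivable_C_minus; [|apply derivable_C_const].
      apply derivable_C_mult; [apply Hg; easy|apply Hv].
    - intros h Hh. rewrite Hleft by easy. ring. }
  assert (GV : (g 0 * v 0)%C = 1).
  { replace (g 0 * v 0)%C with (g 0 * v 0 - 1 + 1)%C by ring. rewrite G0. ring. }
  assert (one_neq : RtoC 1 <> 0) by (intro K; apply RtoC_inj in K; lra).
  assert (Ng : g 0 <> 0) by (intro K; rewrite K, Cmult_0_l in GV; now apply one_neq).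
  assert (Nv : v 0 <> 0) by (intro K; rewrite K, Cmult_0_r in GV; now apply one_neq).
  destruct (derivable_C_nonzero g 0 _ (proj1 (Hg 0 R0)) Ng) as [r Hr].
  set (d' := Rmin d r).
  assert (Hd' : 0 < d') by (apply Rmin_glb_lt; [easy|apply cond_pos]).
  assert (Ld : d' <= d) by apply Rmin_l. assert (Lr : d' <= r) by apply Rmin_r.
  assert (NE : forall h, Rabs h < d' -> g h <> 0 /\ twice_derivable_C g g1 g2 h).
  { intros h Hh. split; [|apply Hg; lra]. apply Hr.
    change (Rabs (h - 0) < r). rewrite Rminus_0_r. lra. }
  assert (HU := twice_derivable_inv g g1 g2 d' NE).
  set (u := fun s => (/ g s)%C) in *.
  set (u1 := fun s => (- (g1 s * (u s * u s)))%C).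
  assert (Hm' : 0 < Rmin d' t0) by (apply Rmin_glb_lt; lra).
  assert (Hleft' : forall h, - Rmin d' t0 < h < 0 -> u h = v h).
  { intros h Hh. assert (M1 := Rmin_l d' t0). assert (M2 := Rmin_r d' t0).
    assert (L := Hleft h). assert (Ha : Rabs h < d') by (rewrite Rabs_left; lra).
    destruct (NE h Ha) as [N _]. unfold u.
    replace (v h) with (g h * v h * / g h)%C by (field; easy).
    rewrite L; [ring|]. split; [|lra].
    enough (- Rmin d t0 <= - Rmin d' t0) by lra.
    apply Ropp_le_contravar, Rle_min_compat_r; easy. }
  (* u and v coincide on the left, hence so do their second-order jets at 0. *)
  assert (R0' : Rabs 0 < d') by now rewrite Rabs_R0.
  destruct (HU 0 R0') as [U1 U2]. destruct (Hv 0) as [V1 V2].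
  destruct (left_derivative_zero_C (fun s => u s - v s)%C _ (Rmin d' t0) Hm'
    (derivable_C_minus _ _ _ _ _ U1 V1)) as [J0 J1].
  { intros h Hh. rewrite Hleft' by easy. ring. }
  destruct (left_derivative_zero_C (fun s => u1 s - v1 s)%C _ (Rmin d' t0) Hm'
    (derivable_C_minus _ _ _ _ _ U2 V2)) as [_ J2].
  { intros h Hh. assert (M1 := Rmin_l d' t0).
    assert (Ha : Rabs h < d') by (rewrite Rabs_left; lra).
    destruct (HU h Ha) as [A _]. destruct (Hv h) as [B _].
    assert (A' : derivable_C v h (u1 h)).
    { eapply derivable_C_ext_loc; [|exact A].
      assert (Hp : 0 < Rmin (- h) (Rmin d' t0 + h)) by (apply Rmin_glb_lt; lra).
      exists (mkposreal _ Hp). intros s Hs. change R in s.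
      change (Rabs (s - h) < Rmin (- h) (Rmin d' t0 + h)) in Hs.
      assert (M3 := Rmin_l (- h) (Rmin d' t0 + h)).
      assert (M4 := Rmin_r (- h) (Rmin d' t0 + h)).
      apply Rabs_def2 in Hs. apply Hleft'. lra. }
    rewrite (derivable_C_unique _ _ _ _ A' B). ring. }
  assert (eq_of_sub : forall a b : C, (a - b)%C = 0 -> a = b).
  { intros a b K. replace a with (a - b + b)%C by ring. rewrite K. ring. }
  apply eq_of_sub in J0, J1, J2.
  assert (Et0 : t0 + 0 = t0) by ring.
  destruct (inverse_wp_after w1 w2 S S1 t0 d' u u1 _ hwp HS Hd' HU) as [e [He Hu]].
  - intros h Hh. assert (Ha : Rabs h < d') by (rewrite Rabs_right; lra).
    destruct (Hwg h ltac:(lra)) as [A B]. split; [easy|]. rewrite B.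
    destruct (NE _ Ha) as [N _]. unfold u. field. easy.
  - rewrite J0. unfold v. now rewrite Et0.
  - etransitivity; [exact J1|]. unfold v1. now rewrite Et0.
  -
    (* If S1 = 0 then S^4 = 27/4, so that 2 - (8/9) S^4 = -4. *)
    destruct (Ceq_dec (u1 0) 0) as [Z1|NZ1]; [right|now left].
    intro Z2. rewrite J2 in Z2. assert (Z1' := eq_trans (eq_sym J1) Z1).
    unfold v1 in Z1'. unfold v2 in Z2. apply RtoC_inj in Z1', Z2.
    unfold v in Nv. rewrite Et0 in *.
    assert (NS : S t0 <> 0).
    { intro K. apply Nv. rewrite K. f_equal. ring. }
    assert (S10 : S1 t0 = 0) by nra.
    destruct (HS t0) as [_ [_ F]]. rewrite S10 in F. lra.
  - exists e. split; [easy|]. intros t Ht.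
    assert (Ha : Rabs (t - t0) < d') by (rewrite Rabs_right; lra).
    destruct (Hwg (t - t0) ltac:(lra)) as [A B].
    assert (F := Hu (t - t0) ltac:(lra)).
    replace (t0 + (t - t0)) with t in * by ring.
    split; [intro; easy|intros _]. rewrite B, <- F.
    destruct (NE _ Ha) as [N _]. unfold u. field. easy.
Qed.

Lemma wp_lemniscate (w1 w2 : C) (S S1 : R -> R) :
  is_lattice_basis w1 w2 ->
  wp_satisfies_ode w1 w2 (RtoC (16 / 27)) (RtoC 0) ->
  lemniscatic S S1 -> S 0 = 0 ->
  forall t, 0 <= t -> wp_matches w1 w2 S t.
Proof.
  intros hw hwp HS HS0. apply real_induction.
  intros t0 Ht0 Hb.
  destruct (Classical_Prop.classic (in_lattice w1 w2 (RtoC t0))).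
  - now apply (wp_matches_after_pole w1 w2 S S1 t0).
  - now apply (wp_matches_after_regular w1 w2 S S1 t0).
Qed.

(** * Orbits of the octahedral flow *)

(** The group law moves the derivative at time 0 along the orbit. *)
Lemma time_map_derivative (phi : R * R * R -> R * R * R) (p : R * R * R) (t : R) :
  is_octahedral_superflow phi ->
  is_derive (fun s => time_map phi s p) t (octahedral_field (time_map phi t p)).
Proof.
  intros [[Hadd _] Hfield].
  apply (is_derive_ext (fun s => time_map phi (s - t) (time_map phi t p))).
  { intro s. rewrite <- Hadd. f_equal. simpl. ring. }
  set (X := octahedral_field (time_map phi t p)).
  replace X with (scal 1 X) by apply (scal_one (K := R_AbsRing)).
  apply (is_derive_comp (fun h => time_map phi h (time_map phi t p))
           (fun s => s - t) t X 1).
  - rewrite Rminus_diag. apply Hfield.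
  - auto_derive; [easy|ring].
Qed.

Lemma is_derive_fst {U V : NormedModule R_AbsRing} (f : R -> U * V) (t : R) (l : U * V) :
  is_derive f t l -> is_derive (fun s => fst (f s)) t (fst l).
Proof.
  intro H.
  apply (filterdiff_ext_lin _ (fun y : R_AbsRing => fst (scal y l))); [|easy].
  apply (filterdiff_comp' f (@fst U V) t _ _ H).
  apply filterdiff_linear, is_linear_fst.
Qed.

Lemma is_derive_snd {U V : NormedModule R_AbsRing} (f : R -> U * V) (t : R) (l : U * V) :
  is_derive f t l -> is_derive (fun s => snd (f s)) t (snd l).
Proof.
  intro H.
  apply (filterdiff_ext_lin _ (fun y : R_AbsRing => snd (scal y l))); [|easy].
  apply (filterdiff_comp' f (@snd U V) t _ _ H).
  apply filterdiff_linear, is_linear_snd.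
Qed.

Lemma is_derive_zero_constant (f : R -> R) :
  (forall t, is_derive f t 0) -> forall t, f t = f 0.
Proof.
  intros H t. destruct (Rtotal_order t 0) as [L|[->|L]]; [|easy|].
  - apply (eq_is_derive (V := R_NormedModule)); [intros; apply H|easy].
  - symmetry. apply (eq_is_derive (V := R_NormedModule)); [intros; apply H|easy].
Qed.

(** On the unit sphere the denominator of the field is 1. *)
Definition octahedral_orbit (x y z : R -> R) : Prop :=
  forall t,
    is_derive x t (y t * z t * (y t ^ 2 - z t ^ 2)) /\
    is_derive y t (z t * x t * (z t ^ 2 - x t ^ 2)) /\
    is_derive z t (x t * y t * (x t ^ 2 - y t ^ 2)) /\
    x t ^ 2 + y t ^ 2 + z t ^ 2 = 1 /\
    x t ^ 4 + y t ^ 4 + z t ^ 4 = 5 / 9.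

(** The derivative of [x^2 + y^2 + z^2] along the flow is zero whatever the value of the
    denominator, so the radius is seen to be constant before the denominator is known to be
    nonzero. *)
Lemma unit_orbit (phi : R * R * R -> R * R * R) (x0 y0 z0 : R) :
  is_octahedral_superflow phi ->
  x0 ^ 2 + y0 ^ 2 + z0 ^ 2 = 1 -> x0 ^ 4 + y0 ^ 4 + z0 ^ 4 = 5 / 9 ->
  exists x y z, octahedral_orbit x y z /\
    (forall t, time_map phi t (x0, y0, z0) = (x t, y t, z t)) /\
    x 0 = x0 /\ y 0 = y0 /\ z 0 = z0.
Proof.
  intros Hphi H2 H4.
  set (F := fun t => time_map phi t (x0, y0, z0)).
  set (x := fun t => fst (fst (F t))). set (y := fun t => snd (fst (F t))).
  set (z := fun t => snd (F t)).
  assert (EF : forall t, F t = (x t, y t, z t)).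
  { intro t. unfold x, y, z. now destruct (F t) as [[a b] c]. }
  assert (E0 : F 0 = (x0, y0, z0)).
  { unfold F, time_map. destruct (Req_EM_T 0 0); easy. }
  assert (Ix : x 0 = x0) by (unfold x; now rewrite E0).
  assert (Iy : y 0 = y0) by (unfold y; now rewrite E0).
  assert (Iz : z 0 = z0) by (unfold z; now rewrite E0).
  set (r2 := fun t => x t ^ 2 + y t ^ 2 + z t ^ 2).
  assert (D : forall t,
    is_derive x t ((y t ^ 3 * z t - y t * z t ^ 3) / r2 t) /\
    is_derive y t ((z t ^ 3 * x t - z t * x t ^ 3) / r2 t) /\
    is_derive z t ((x t ^ 3 * y t - x t * y t ^ 3) / r2 t)).
  { intro t. assert (H := time_map_derivative phi (x0, y0, z0) t Hphi).
    fold F in H. change (time_map phi t (x0, y0, z0)) with (F t) in H.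
    rewrite EF in H. simpl in H.
    assert (Hz := is_derive_snd (U := prod_NormedModule _ R_NormedModule R_NormedModule)
       (V := R_NormedModule) _ _ _ H).
    assert (Hxy := is_derive_fst (U := prod_NormedModule _ R_NormedModule R_NormedModule)
       (V := R_NormedModule) _ _ _ H).
    assert (Hx := is_derive_fst (U := R_NormedModule) (V := R_NormedModule) _ _ _ Hxy).
    assert (Hy := is_derive_snd (U := R_NormedModule) (V := R_NormedModule) _ _ _ Hxy).
    split; [exact Hx|split; [exact Hy|exact Hz]]. }
  clearbody x y z.
  assert (R2 : forall t, r2 t = 1).
  { intro t. rewrite (is_derive_zero_constant r2).
    - unfold r2. now rewrite Ix, Iy, Iz.
    - intro s. destruct (D s) as [Dx [Dy Dz]]. unfold r2 at 1.
      auto_derive; [repeat split; eexists; eassumption|].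
      rewrite (is_derive_unique (fun u : R => x u) _ _ Dx), (is_derive_unique (fun u : R => y u) _ _ Dy),
        (is_derive_unique (fun u : R => z u) _ _ Dz). unfold Rdiv. ring. }
  assert (D' : forall t,
    is_derive x t (y t * z t * (y t ^ 2 - z t ^ 2)) /\
    is_derive y t (z t * x t * (z t ^ 2 - x t ^ 2)) /\
    is_derive z t (x t * y t * (x t ^ 2 - y t ^ 2))).
  { intro t. destruct (D t) as [Dx [Dy Dz]]. rewrite R2 in Dx, Dy, Dz.
    replace (y t * z t * (y t ^ 2 - z t ^ 2))
      with ((y t ^ 3 * z t - y t * z t ^ 3) / 1) by field.
    replace (z t * x t * (z t ^ 2 - x t ^ 2))
      with ((z t ^ 3 * x t - z t * x t ^ 3) / 1) by field.
    replace (x t * y t * (x t ^ 2 - y t ^ 2))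
      with ((x t ^ 3 * y t - x t * y t ^ 3) / 1) by field. easy. }
  exists x, y, z. split; [|now repeat split].
  intro t. destruct (D' t) as [Dx [Dy Dz]]. split; [exact Dx|split; [exact Dy|split; [exact Dz|split]]].
  - apply R2.
  - rewrite (is_derive_zero_constant (fun t => x t ^ 4 + y t ^ 4 + z t ^ 4)).
    + now rewrite Ix, Iy, Iz.
    + clear Dx Dy Dz. intro s. destruct (D' s) as [Dx [Dy Dz]].
      auto_derive; [repeat split; eexists; eassumption|].
      rewrite (is_derive_unique (fun u : R => x u) _ _ Dx), (is_derive_unique (fun u : R => y u) _ _ Dy),
        (is_derive_unique (fun u : R => z u) _ _ Dz). ring.
Qed.

Definition vandermonde (a b c : R) : R := (a - b) * (b - c) * (a - c).

(** With [e1 = 1] and [e2 = 2/9] the product [b c] is [e2 - a (1 - a)]; in this form the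
    cubic satisfied by [a, b, c] appears factored. *)
Lemma other_roots_product (a b c : R) :
  a + b + c = 1 -> a ^ 2 + b ^ 2 + c ^ 2 = 5 / 9 ->
  b * c = (a - 1 / 3) * (a - 2 / 3).
Proof.
  intros H1 H2.
  replace (b * c) with (((b + c) ^ 2 - (b ^ 2 + c ^ 2)) / 2) by field.
  replace (b + c) with (1 - a) by lra.
  replace (b ^ 2 + c ^ 2) with (5 / 9 - a ^ 2) by lra. field.
Qed.

Lemma root_gaps_product (a b c : R) :
  a + b + c = 1 -> a ^ 2 + b ^ 2 + c ^ 2 = 5 / 9 ->
  (a - b) * (a - c) = 3 * a ^ 2 - 2 * a + 2 / 9.
Proof.
  intros H1 H2.
  transitivity (a ^ 2 - a * (b + c) + b * c); [ring|].
  rewrite (other_roots_product a b c H1 H2).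
  replace (b + c) with (1 - a) by lra. field.
Qed.

Lemma other_roots_gap_sqr (a b c : R) :
  a + b + c = 1 -> a ^ 2 + b ^ 2 + c ^ 2 = 5 / 9 ->
  (b - c) ^ 2 = - 3 * a ^ 2 + 2 * a + 1 / 9.
Proof.
  intros H1 H2.
  transitivity ((b + c) ^ 2 - 4 * (b * c)); [ring|].
  rewrite (other_roots_product a b c H1 H2).
  replace (b + c) with (1 - a) by lra. field.
Qed.

Lemma vandermonde_sqr_root (a b c : R) :
  a + b + c = 1 -> a ^ 2 + b ^ 2 + c ^ 2 = 5 / 9 ->
  vandermonde a b c ^ 2
  = (- 3 * a ^ 2 + 2 * a + 1 / 9) * (3 * a ^ 2 - 2 * a + 2 / 9) ^ 2.
Proof.
  intros H1 H2. unfold vandermonde.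
  rewrite <- (root_gaps_product a b c H1 H2), <- (other_roots_gap_sqr a b c H1 H2).
  ring.
Qed.

(** The discriminant of [a^3 - a^2 + (2/9) a - p]: its terms linear in [p] cancel for
    these values of [e1] and [e2]. *)
Lemma vandermonde_sqr (a b c : R) :
  a + b + c = 1 -> a ^ 2 + b ^ 2 + c ^ 2 = 5 / 9 ->
  vandermonde a b c ^ 2 = 4 / 729 - 27 * (a * b * c) ^ 2.
Proof.
  intros H1 H2. rewrite (vandermonde_sqr_root a b c H1 H2), (Rmult_assoc a b c),
    (other_roots_product a b c H1 H2). field.
Qed.

(** The left-hand side is the derivative of the Vandermonde product along the flow, up to
    the factor [2 x y z].  Each of its three terms reduces to a polynomial in one root. *)
Lemma vandermonde_derivative (a b c : R) :
  a + b + c = 1 -> a ^ 2 + b ^ 2 + c ^ 2 = 5 / 9 ->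
  (a + b - 2 * c) * (b - c) * (a - c) + (a - b) * (b + c - 2 * a) * (a - c)
  + (a - b) * (b - c) * (2 * b - a - c) = - 27 * (a * b * c).
Proof.
  intros H1 H2.
  assert (T : forall u v w, u + v + w = 1 -> u ^ 2 + v ^ 2 + w ^ 2 = 5 / 9 ->
    (v + w - 2 * u) * ((u - v) * (u - w)) = - 9 * (u * v * w) - 2 / 3 * u + 2 / 9).
  { intros u v w K1 K2. rewrite (root_gaps_product u v w K1 K2), (Rmult_assoc u v w),
      (other_roots_product u v w K1 K2).
    replace (v + w - 2 * u) with (1 - 3 * u) by lra. field. }
  assert (Ta := T a b c H1 H2).
  assert (Tb := T b a c ltac:(lra) ltac:(lra)).
  assert (Tc := T c a b ltac:(lra) ltac:(lra)).
  lra.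
Qed.

Lemma orbit_lemniscatic (x y z : R -> R) :
  octahedral_orbit x y z ->
  lemniscatic (fun t => 27 / 2 * (x t * y t * z t))
    (fun t => 27 / 2 * vandermonde (x t ^ 2) (y t ^ 2) (z t ^ 2)).
Proof.
  intros H t. destruct (H t) as [Dx [Dy [Dz [E2 E4]]]].
  assert (E4' : (x t ^ 2) ^ 2 + (y t ^ 2) ^ 2 + (z t ^ 2) ^ 2 = 5 / 9)
    by (rewrite <- E4; ring).
  split; [|split].
  - auto_derive; [repeat split; eexists; eassumption|].
    rewrite (is_derive_unique (fun u : R => x u) _ _ Dx), (is_derive_unique (fun u : R => y u) _ _ Dy),
        (is_derive_unique (fun u : R => z u) _ _ Dz). unfold vandermonde. field.
  - unfold vandermonde. auto_derive; [repeat split; eexists; eassumption|].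
    rewrite (is_derive_unique (fun u : R => x u) _ _ Dx), (is_derive_unique (fun u : R => y u) _ _ Dy),
        (is_derive_unique (fun u : R => z u) _ _ Dz).
    assert (V := vandermonde_derivative _ _ _ E2 E4').
    transitivity (27 / 2 * (2 * (x t * y t * z t)) *
      ((x t ^ 2 + y t ^ 2 - 2 * z t ^ 2) * (y t ^ 2 - z t ^ 2) * (x t ^ 2 - z t ^ 2)
       + (x t ^ 2 - y t ^ 2) * (y t ^ 2 + z t ^ 2 - 2 * x t ^ 2) * (x t ^ 2 - z t ^ 2)
       + (x t ^ 2 - y t ^ 2) * (y t ^ 2 - z t ^ 2)
         * (2 * y t ^ 2 - x t ^ 2 - z t ^ 2))).
    + field.
    + rewrite V. field.
  - cbv beta. rewrite Rpow_mult_distr, (vandermonde_sqr _ _ _ E2 E4'). field.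
Qed.

(** The product of the other two squares is [(x^2 - 1/3) (x^2 - 2/3) >= 0], so [x] cannot
    cross the value 7/10, whose square lies strictly between 1/3 and 2/3. *)
Lemma orbit_largest_coordinate (x y z : R -> R) (t : R) :
  octahedral_orbit x y z -> 0 <= x 0 -> 2 / 3 <= x 0 ^ 2 -> 0 <= t ->
  0 < x t /\ 2 / 3 <= x t ^ 2.
Proof.
  intros H Hx0 Hx02 Ht.
  assert (Hgap : forall s, ~ (1 / 3 < x s ^ 2 < 2 / 3)).
  { intros s Hs. destruct (H s) as [_ [_ [_ [E2 E4]]]].
    assert (P : y s ^ 2 * z s ^ 2 = (x s ^ 2 - 1 / 3) * (x s ^ 2 - 2 / 3)).
    { assert (E4' : (x s ^ 2) ^ 2 + (y s ^ 2) ^ 2 + (z s ^ 2) ^ 2 = 5 / 9)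
        by (rewrite <- E4; ring).
      now apply other_roots_product. }
    assert (0 <= y s ^ 2 * z s ^ 2) by (apply Rmult_le_pos; apply pow2_ge_0).
    nra. }
  assert (Hc : continuity x).
  { intro s. apply derivable_continuous_pt. destruct (H s) as [Dx _].
    eexists. apply is_derive_Reals. exact Dx. }
  assert (Hlow : 7 / 10 < x t).
  { apply Rnot_le_lt. intro Hle.
    assert (H0 : 7 / 10 < x 0) by nra.
    assert (Hlt : 0 < t).
    { destruct (Req_dec t 0) as [->|]; lra. }
    destruct (IVT_cor (fun s => x s - 7 / 10) 0 t) as [s [Hs Es]].
    - apply continuity_minus; [exact Hc|]. apply continuity_const. now intros ? ?.
    - lra.
    - nra.
    - apply (Hgap s). replace (x s) with (7 / 10) by lra. lra. }
  split; [lra|].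
  apply Rnot_lt_le. intro Hlt. apply (Hgap t). nra.
Qed.

(** Euler's argument: with [S s] and [m (t - s)] in the right-hand side the quotient does
    not depend on [s], and it equals [m t] at [s = 0] and the claimed value at [s = t]. *)
Lemma lemniscatic_addition (S S1 m m1 : R -> R) (t : R) :
  lemniscatic S S1 -> S 0 = 0 -> S1 0 = 1 -> lemniscatic m m1 ->
  m t = (S t * m1 0 + S1 t * m 0) / (1 + 4 / 27 * (S t ^ 2 * m 0 ^ 2)).
Proof.
  intros HS S0 S10 Hm.
  set (G := fun s => (S s * m1 (t - s) + S1 s * m (t - s))
     / (1 + 4 / 27 * (S s ^ 2 * m (t - s) ^ 2))).
  assert (Pos : forall s, 0 < 1 + 4 / 27 * (S s ^ 2 * m (t - s) ^ 2)).
  { intro s. assert (0 <= S s ^ 2 * m (t - s) ^ 2)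
      by (apply Rmult_le_pos; apply pow2_ge_0). lra. }
  assert (HG : forall s, is_derive G s 0).
  { intro s. destruct (HS s) as [A [A1 EA]]. destruct (Hm (t - s)) as [M [M1 EM]].
    assert (P := Pos s). unfold G. auto_derive.
    - repeat split; try (eexists; eassumption). change (t + - s) with (t - s). simpl in P. lra.
    - replace (t + - s) with (t - s) by ring.
      rewrite (is_derive_unique (fun u : R => S u) _ _ A), (is_derive_unique (fun u : R => S1 u) _ _ A1).
      rewrite (is_derive_unique (fun u : R => m u) _ _ M),
        (is_derive_unique (fun u : R => m1 u) _ _ M1).
      revert EA EM P. generalize (S s) (S1 s) (m (t - s)) (m1 (t - s)).
      intros a a1 b b1 EA EM P.
      apply Rmult_eq_reg_r with ((1 + 4 / 27 * (a ^ 2 * b ^ 2)) ^ 2);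
        [|apply pow_nonzero; lra].
      transitivity (8 / 27 * a * b * ((b ^ 2 - a ^ 2) * (1 + 4 / 27 * (a ^ 2 * b ^ 2))
        - (a1 ^ 2 * b ^ 2 - a ^ 2 * b1 ^ 2))).
      + field. simpl in P. lra.
      + replace (a1 ^ 2) with (1 - 4 / 27 * a ^ 4) by lra.
        replace (b1 ^ 2) with (1 - 4 / 27 * b ^ 4) by lra. field. }
  assert (E := is_derive_zero_constant G HG t).
  unfold G in E. rewrite Rminus_diag, Rminus_0_r, S0, S10 in E.
  rewrite E. field.
Qed.

(** * The cubic equation and its cube root *)

Lemma octJ_pair (T : R) : octJ T = (- 108 * T, 12 * sqrt (12 - 81 * T ^ 2)).
Proof.
  unfold octJ. apply injective_projections; simpl; ring.
Qed.

Lemma sqrt3_sqr : sqrt 3 * sqrt 3 = 3.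
Proof. apply sqrt_sqrt. lra. Qed.

Lemma Cmod_octJ (T : R) : 0 <= 12 - 81 * T ^ 2 -> Cmod (octJ T) = 24 * sqrt 3.
Proof.
  intro H. rewrite octJ_pair. unfold Cmod; cbn [fst snd].
  rewrite (Rpow_mult_distr 12), (pow2_sqrt _ H).
  assert (E := sqrt3_sqr). assert (P := sqrt_lt_R0 3 ltac:(lra)).
  rewrite <- (sqrt_pow2 (24 * sqrt 3)) by lra. f_equal. nra.
Qed.

Lemma cube_root_unique_nonneg (a b : R) : 0 <= a -> 0 < b -> a ^ 3 = b ^ 3 -> a = b.
Proof.
  intros Ha Hb H.
  assert (F : (a - b) * (a ^ 2 + a * b + b ^ 2) = 0) by (simpl in H |- *; lra).
  apply Rmult_integral in F. destruct F as [F|F]; [lra|]. nra.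
Qed.

(** The angle is [acos (Re J / |J|) / 3], by the triple-angle formulas. *)
Lemma octJ_cube_root_exists (T : R) :
  0 <= 12 - 81 * T ^ 2 -> exists c, is_cube_root (octJ T) c.
Proof.
  intro H.
  assert (E := sqrt3_sqr). assert (P := sqrt_lt_R0 3 ltac:(lra)).
  set (s := sqrt 3) in *.
  set (X := - 108 * T / (24 * s)).
  assert (EX : 24 * s * X = - 108 * T) by (unfold X; field; lra).
  assert (X2 : X ^ 2 = 27 / 4 * T ^ 2).
  { assert (K : (24 * s * X) ^ 2 = (- 108 * T) ^ 2) by now rewrite EX.
    assert (K2 : (24 * s * X) ^ 2 = 576 * (s * s) * X ^ 2) by ring.
    rewrite E in K2. lra. }
  assert (HX : -1 <= X <= 1) by (split; nra).
  set (th := acos X / 3).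
  assert (B := acos_bound X).
  assert (Hc : 4 * cos th ^ 3 - 3 * cos th = X).
  { rewrite <- (cos_acos X HX). replace (acos X) with (2 * th + th) by (unfold th; field).
    rewrite cos_plus, cos_2a_cos, sin_2a.
    replace (2 * sin th * cos th * sin th) with (2 * cos th * (sin th * sin th)) by ring.
    assert (S := sin2_cos2 th). unfold Rsqr in S.
    replace (sin th * sin th) with (1 - cos th * cos th) by lra. ring. }
  assert (Hs : 3 * sin th - 4 * sin th ^ 3 = sqrt (1 - X ^ 2)).
  { rewrite <- Rsqr_pow2, <- (sin_acos X HX).
    replace (acos X) with (2 * th + th) by (unfold th; field).
    rewrite sin_plus, cos_2a_sin, sin_2a.
    replace (2 * sin th * cos th * cos th) with (2 * sin th * (cos th * cos th)) by ring.
    assert (S := sin2_cos2 th). unfold Rsqr in S.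
    replace (cos th * cos th) with (1 - sin th * sin th) by lra. ring. }
  assert (S := sin2_cos2 th). unfold Rsqr in S.
  set (c := (RtoC (2 * s) * (RtoC (cos th) + Ci * RtoC (sin th)))%C).
  assert (Ec : c = (2 * s * cos th, 2 * s * sin th)).
  { unfold c. apply injective_projections; simpl; ring. }
  exists c. split.
  - rewrite octJ_pair, Ec. apply injective_projections.
    + transitivity (8 * s * (s * s) * (cos th ^ 3 - 3 * cos th * (sin th * sin th)));
        [simpl; ring|cbn [fst]].
      rewrite E, <- EX, <- Hc.
      replace (sin th * sin th) with (1 - cos th * cos th) by lra. ring.
    + transitivity (8 * s * (s * s) * (3 * sin th * (cos th * cos th) - sin th ^ 3));
        [simpl; ring|cbn [snd]].
      replace (cos th * cos th) with (1 - sin th * sin th) by lra.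
      rewrite E.
      transitivity (24 * s * (3 * sin th - 4 * sin th ^ 3)); [ring|].
      rewrite Hs, X2.
      replace (12 - 81 * T ^ 2) with (12 * (1 - 27 / 4 * T ^ 2)) by field.
      rewrite sqrt_mult by lra.
      replace (sqrt 12) with (2 * s); [ring|].
      symmetry. replace 12 with ((2 * s) ^ 2) by lra.
      apply sqrt_pow2. lra.
  - exists th. split.
    + unfold th. rewrite Rabs_right; lra.
    + replace (Cmod c) with (2 * s); [easy|].
      rewrite Ec. unfold Cmod; cbn [fst snd].
      replace ((2 * s * cos th) ^ 2 + (2 * s * sin th) ^ 2) with ((2 * s) ^ 2).
      * symmetry. apply sqrt_pow2. lra.
      * transitivity ((2 * s) ^ 2 * (sin th * sin th + cos th * cos th)); [|ring].
        rewrite S. ring.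
Qed.

(** Since [|c|^2 = 12], the second summand is the conjugate of the first and the sum is
    [u / 9 + 1/3] with [u = Re c].  The triple-angle formula says that this number is a root
    of [a (a - 1/3) (a - 2/3) = - T / 27], and a root in [a >= 2/3] is the only root above
    1/3. *)
Lemma octJ_cube_root_value (T a : R) (c : C) :
  T = - 27 * (a * (a - 1 / 3) * (a - 2 / 3)) -> 2 / 3 <= a ->
  0 <= 12 - 81 * T ^ 2 -> is_cube_root (octJ T) c ->
  (c / 18 + 2 / (3 * c) + 1 / 3)%C = RtoC a.
Proof.
  intros HT Ha H [Hc [th [Hth Ec]]].
  assert (E := sqrt3_sqr). assert (P := sqrt_lt_R0 3 ltac:(lra)).
  assert (Hm : Cmod c = 2 * sqrt 3).
  { apply cube_root_unique_nonneg; [apply Cmod_ge_0|lra|].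
    rewrite <- Cmod_pow, Hc, Cmod_octJ by easy.
    transitivity (8 * sqrt 3 * (sqrt 3 * sqrt 3)); [rewrite E; ring|ring]. }
  assert (Hcos : 0 < cos th).
  { assert (B : - (PI / 3) <= th <= PI / 3) by (split_Rabs; lra).
    assert (Q := PI_RGT_0). apply cos_gt_0; lra. }
  rewrite Hm in Ec. rewrite octJ_pair in Hc.
  set (u := 2 * sqrt 3 * cos th). set (v := 2 * sqrt 3 * sin th).
  assert (Euv : c = (u, v)).
  { rewrite Ec. unfold u, v. apply injective_projections; simpl; ring. }
  assert (N : u ^ 2 + v ^ 2 = 12).
  { transitivity (4 * (sqrt 3 * sqrt 3) * ((sin th)² + (cos th)²)).
    - unfold u, v, Rsqr. ring.
    - rewrite sin2_cos2, E. ring. }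
  assert (Hu : 0 < u) by (unfold u; apply Rmult_lt_0_compat; lra).
  clearbody u v. clear Ec Hm. subst c.
  apply (f_equal fst) in Hc. simpl in Hc.
  assert (Eb : 4 * u ^ 3 - 36 * u = - 108 * T).
  { rewrite <- Hc. replace (4 * u ^ 3 - 36 * u) with (u ^ 3 - 3 * u * (12 - u ^ 2)) by ring.
    rewrite <- N. ring. }
  assert (Eu : u = 9 * (a - 1 / 3)).
  { rewrite HT in Eb.
    assert (F : (u - 9 * (a - 1 / 3))
       * (u ^ 2 + u * (9 * (a - 1 / 3)) + (9 * (a - 1 / 3)) ^ 2 - 9) = 0).
    { transitivity ((4 * u ^ 3 - 36 * u
        - - 108 * (- 27 * (a * (a - 1 / 3) * (a - 2 / 3)))) / 4); [field|].
      rewrite Eb. field. }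
    apply Rmult_integral in F. destruct F as [F|F]; [lra|].
    exfalso. assert (0 < u * (9 * (a - 1 / 3))) by (apply Rmult_lt_0_compat; lra). nra. }
  assert (Ninv : (/ (u, v))%C = (u / 12, - v / 12)).
  { unfold Cdiv, Cinv, Cmult. cbn [fst snd]. rewrite N.
    apply injective_projections; simpl; field. }
  replace (2 / (3 * (u, v)))%C with (2 / 3 * / (u, v))%C.
  - rewrite Ninv. rewrite Eu. unfold Cdiv, Cinv, Cmult, Cplus, RtoC. cbn [fst snd].
    apply injective_projections; simpl; field.
  - field. intro K. apply (f_equal fst) in K. simpl in K. lra.
Qed.

(** * The formula for T *)

Lemma admissible_unit (x y z : R) :
  admissible x y z ->
  let r := rad x y z in
  0 < r /\ x = r * (x / r) /\ y = r * (y / r) /\ z = r * (z / r) /\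
  (x / r) ^ 2 + (y / r) ^ 2 + (z / r) ^ 2 = 1 /\
  (x / r) ^ 4 + (y / r) ^ 4 + (z / r) ^ 4 = 5 / 9 /\
  2 / 3 <= (x / r) ^ 2 /\ 0 <= x / r /\ 0 <= z / r <= y / r.
Proof.
  intros [Hx [Hy [Hz [Hne [Hzy [Hq Hx2]]]]]] r.
  assert (P : 0 < x ^ 2 + y ^ 2 + z ^ 2).
  { assert (A := pow2_ge_0 x). assert (B := pow2_ge_0 y). assert (C := pow2_ge_0 z).
    apply Rnot_le_lt. intro. apply Hne.
    repeat split; apply Rsqr_0_uniq; rewrite Rsqr_pow2; lra. }
  assert (Hr : 0 < r) by (apply sqrt_lt_R0; exact P).
  assert (Er : r ^ 2 = x ^ 2 + y ^ 2 + z ^ 2).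
  { unfold r, rad. rewrite pow2_sqrt; lra. }
  assert (Hr2 : 0 < r ^ 2) by now apply pow_lt.
  assert (E4 : x ^ 4 + y ^ 4 + z ^ 4 = 5 / 9 * r ^ 4).
  { assert (Q : 0 < x ^ 4 + y ^ 4 + z ^ 4).
    { replace (x ^ 4) with ((x ^ 2) ^ 2) by ring. replace (y ^ 4) with ((y ^ 2) ^ 2) by ring.
      replace (z ^ 4) with ((z ^ 2) ^ 2) by ring.
      assert (A := pow2_ge_0 x). assert (B := pow2_ge_0 y). assert (C := pow2_ge_0 z).
      nra. }
    rewrite <- Er in Hq. replace (r ^ 4) with ((r ^ 2) ^ 2) by ring.
    replace ((r ^ 2) ^ 2) with (9 / 5 * (x ^ 4 + y ^ 4 + z ^ 4))
      by (rewrite <- Hq; field; lra). field. }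
  split; [easy|].
  split; [field; lra|]. split; [field; lra|]. split; [field; lra|].
  split; [|split; [|split]].
  - transitivity ((x ^ 2 + y ^ 2 + z ^ 2) / r ^ 2); [field; lra|].
    rewrite <- Er. field. lra.
  - transitivity ((x ^ 4 + y ^ 4 + z ^ 4) / r ^ 4); [field; lra|].
    rewrite E4. field. lra.
  - rewrite <- Er in Hx2. replace ((x / r) ^ 2) with (x ^ 2 / r ^ 2) by (field; lra).
    apply Rmult_le_reg_r with (r ^ 2); [easy|].
    replace (x ^ 2 / r ^ 2 * r ^ 2) with (x ^ 2) by (field; lra). lra.
  - assert (I : 0 < / r) by now apply Rinv_0_lt_compat. unfold Rdiv.
    split; [apply Rmult_le_pos; lra|]. split; [apply Rmult_le_pos; lra|].
    apply Rmult_le_compat_r; lra.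
Qed.

(** The value and the slope at time 0 of [m = (27/2) x y z] along the orbit through the
    projection of the point to the unit sphere. *)
Definition start_value (x y z : R) : R :=
  let r := rad x y z in 27 / 2 * (x / r * (y / r) * (z / r)).

Definition start_slope (x y z : R) : R :=
  let r := rad x y z in
  27 / 2 * vandermonde ((x / r) ^ 2) ((y / r) ^ 2) ((z / r) ^ 2).

Lemma octK_scale (r x y z : R) :
  0 < r -> x ^ 2 + y ^ 2 + z ^ 2 = 1 -> octK (r * x) (r * y) (r * z) = octK x y z.
Proof.
  intros Hr H. unfold octK.
  replace ((r * x) ^ 2 + (r * y) ^ 2 + (r * z) ^ 2) with (r ^ 2 * (x ^ 2 + y ^ 2 + z ^ 2))
    by ring.
  rewrite H. field. lra.
Qed.

Lemma octL_scale (r x y z : R) :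
  0 < r -> x ^ 2 + y ^ 2 + z ^ 2 = 1 -> octL (r * x) (r * y) (r * z) = octL x y z.
Proof.
  intros Hr H. unfold octL.
  replace ((r * x) ^ 2 + (r * y) ^ 2 + (r * z) ^ 2) with (r ^ 2 * (x ^ 2 + y ^ 2 + z ^ 2))
    by ring.
  rewrite H. field. lra.
Qed.

Lemma sqr_prod3 (a b c : R) : (a * b * c) ^ 2 = a ^ 2 * (b ^ 2 * c ^ 2).
Proof. ring. Qed.

Lemma octK_start (x y z : R) :
  admissible x y z -> octK x y z = - (4 / 27) * start_value x y z ^ 2.
Proof.
  intro H. destruct (admissible_unit x y z H) as [Hr [Ex [Ey [Ez [E2 [E4 _]]]]]].
  unfold start_value. set (r := rad x y z) in *.
  rewrite Ex, Ey, Ez at 1. rewrite octK_scale by easy.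
  revert E2 E4. generalize (x / r) (y / r) (z / r). intros a b c E2 E4.
  rewrite Rpow_mult_distr, sqr_prod3.
  rewrite (other_roots_product (a ^ 2) (b ^ 2) (c ^ 2) E2) by (rewrite <- E4; ring).
  unfold octK. rewrite E2.
  replace (2 * a ^ 2 - b ^ 2 - c ^ 2) with (3 * a ^ 2 - 1) by (rewrite <- E2; ring).
  replace (a ^ 2 - 2 * b ^ 2 - 2 * c ^ 2) with (3 * a ^ 2 - 2) by lra.
  field.
Qed.

(** By [other_roots_product] and [vandermonde_sqr_root], the factors of [L] are [9 p], 9
    times the squared difference of the other two roots, and 18 times the product of their
    distances to [a]. *)
Lemma octL_start (x y z : R) :
  admissible x y z -> octL x y z = (8 / 27 * (start_value x y z * start_slope x y z)) ^ 2.
Proof.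
  intro H. destruct (admissible_unit x y z H) as [Hr [Ex [Ey [Ez [E2 [E4 _]]]]]].
  unfold start_value, start_slope. set (r := rad x y z) in *.
  rewrite Ex, Ey, Ez at 1. rewrite octL_scale by easy.
  revert E2 E4. generalize (x / r) (y / r) (z / r). intros a b c E2 E4.
  assert (E4' : (a ^ 2) ^ 2 + (b ^ 2) ^ 2 + (c ^ 2) ^ 2 = 5 / 9) by (rewrite <- E4; ring).
  transitivity (2916 * (a * b * c) ^ 2 * vandermonde (a ^ 2) (b ^ 2) (c ^ 2) ^ 2);
    [|field].
  rewrite sqr_prod3, (other_roots_product _ _ _ E2 E4'), (vandermonde_sqr_root _ _ _ E2 E4').
  unfold octL. rewrite E2.
  replace (2 * a ^ 2 - b ^ 2 - c ^ 2) with (3 * a ^ 2 - 1) by (rewrite <- E2; ring).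
  replace (a ^ 2 - 2 * b ^ 2 - 2 * c ^ 2) with (3 * a ^ 2 - 2) by lra.
  replace (b ^ 2 + c ^ 2 + 10 * a ^ 2) with (1 + 9 * a ^ 2) by lra.
  replace (2 * b ^ 2 + 2 * c ^ 2 - 7 * a ^ 2) with (2 - 9 * a ^ 2) by lra.
  field.
Qed.

(** This is where [y >= z] enters: it makes the initial slope of [m] nonnegative and so fixes
    the sign of the square root of [L]. *)
Lemma start_nonneg (x y z : R) : admissible x y z -> 0 <= start_value x y z /\ 0 <= start_slope x y z.
Proof.
  intro H. destruct (admissible_unit x y z H)
    as [Hr [_ [_ [_ [E2 [_ [Hx [Px [Pz Hzy]]]]]]]]].
  unfold start_value, start_slope. set (r := rad x y z) in *.
  revert E2 Hx Px Pz Hzy. generalize (x / r) (y / r) (z / r). intros a b c E2 Hx Px Pz Hzy.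
  split.
  - apply Rmult_le_pos; [lra|]. apply Rmult_le_pos; [apply Rmult_le_pos|]; lra.
  - apply Rmult_le_pos; [lra|]. unfold vandermonde.
    assert (A := pow2_ge_0 b). assert (B := pow2_ge_0 c).
    assert (D : c ^ 2 <= b ^ 2) by (apply pow_incr; lra).
    apply Rmult_le_pos; [apply Rmult_le_pos|]; lra.
Qed.

Lemma sqrt_octL (x y z : R) :
  admissible x y z -> sqrt (octL x y z) = 8 / 27 * (start_value x y z * start_slope x y z).
Proof.
  intro H. rewrite octL_start by easy. apply sqrt_pow2.
  destruct (start_nonneg x y z H).
  apply Rmult_le_pos; [lra|now apply Rmult_le_pos].
Qed.

Definition lemniscate_add (s c n n' : R) : R :=
  (s * n' + c * n) / (1 + 4 / 27 * (s ^ 2 * n ^ 2)).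

Lemma lemniscate_add_denominator (s n : R) : 0 < 1 + 4 / 27 * (s ^ 2 * n ^ 2).
Proof.
  assert (0 <= s ^ 2 * n ^ 2) by (apply Rmult_le_pos; apply pow2_ge_0). lra.
Qed.

(** After clearing denominators the difference of the two sides is [1 + (4/27) s^2 n^2]
    times an expression that vanishes by the two first integrals. *)
Lemma weierstrass_addition (s c n n' : R) :
  s <> 0 -> c ^ 2 + 4 / 27 * s ^ 4 = 1 -> n' ^ 2 + 4 / 27 * n ^ 4 = 1 ->
  1 / 4 * ((8 / 27 * (n * n') + - (2 * c) / s ^ 3)
             / (- (4 / 27) * n ^ 2 - 1 / s ^ 2)) ^ 2
    - - (4 / 27) * n ^ 2 - 1 / s ^ 2
  = - (4 / 27) * lemniscate_add s c n n' ^ 2.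
Proof.
  intros Hs Hc Hn. unfold lemniscate_add.
  assert (P := lemniscate_add_denominator s n).
  assert (Hs2 : 0 < s ^ 2) by (apply pow2_gt_0; easy).
  set (d := 1 + 4 / 27 * (s ^ 2 * n ^ 2)) in *.
  assert (Ed : - (4 / 27) * n ^ 2 - 1 / s ^ 2 = - d / s ^ 2)
    by (unfold d; field; easy).
  rewrite Ed.
  apply Rmult_eq_reg_r with (s ^ 2 * d ^ 2);
    [|apply Rmult_integral_contrapositive_currified; [lra|apply pow_nonzero; lra]].
  transitivity ((4 / 27 * n * n' * s ^ 3 - c) ^ 2
     + (4 / 27 * n ^ 2 * s ^ 2 - 1) * d ^ 2); [field; split; lra|].
  transitivity (- (4 / 27) * s ^ 2 * (s * n' + c * n) ^ 2); [|field; lra].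
  transitivity (- (4 / 27) * s ^ 2 * (s * n' + c * n) ^ 2 + d *
    (4 / 27 * s ^ 4 * n' ^ 2 + c ^ 2 + (4 / 27 * n ^ 2 * s ^ 2) ^ 2 - 1)).
  { unfold d. ring. }
  replace (n' ^ 2) with (1 - 4 / 27 * n ^ 4) by lra.
  replace (c ^ 2) with (1 - 4 / 27 * s ^ 4) by lra. field.
Qed.

Lemma octT_formula_real (w1 w2 : C) (x y z p p' : R) :
  wp w1 w2 (RtoC (rad x y z)) = RtoC p -> wp' w1 w2 (RtoC (rad x y z)) = RtoC p' ->
  octK x y z - p <> 0 ->
  octT_formula w1 w2 x y z
  = RtoC (1 / 4 * ((sqrt (octL x y z) + p') / (octK x y z - p)) ^ 2 - octK x y z - p).
Proof.
  intros Hp Hp' Hne. unfold octT_formula. rewrite Hp, Hp'.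
  now rewrite !RtoC_minus, RtoC_mult, RtoC_pow, !RtoC_div, RtoC_plus, RtoC_minus
    by (lra || easy).
Qed.

Lemma wp_real_line (w1 w2 : C) (S S1 : R -> R) (t : R) :
  is_lattice_basis w1 w2 ->
  wp_satisfies_ode w1 w2 (RtoC (16 / 27)) (RtoC 0) ->
  lemniscatic S S1 -> S 0 = 0 -> 0 < t -> ~ in_lattice w1 w2 (RtoC t) ->
  S t <> 0 /\ wp w1 w2 (RtoC t) = RtoC (1 / S t ^ 2) /\
  wp' w1 w2 (RtoC t) = RtoC (- (2 * S1 t) / S t ^ 3).
Proof.
  intros hw hwp HS HS0 Ht Hl.
  assert (Hval : forall s, 0 <= s -> ~ in_lattice w1 w2 (RtoC s) ->
     S s <> 0 /\ wp w1 w2 (RtoC s) = RtoC (1 / S s ^ 2)).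
  { intros s Hs Hls.
    assert (E := proj2 (wp_lemniscate w1 w2 S S1 hw hwp HS HS0 s Hs) Hls).
    assert (N : S s <> 0).
    { intro K. rewrite K in E. replace (0 ^ 2) with 0 in E by ring.
      rewrite Cmult_0_r in E. apply RtoC_inj in E. lra. }
    split; [easy|].
    assert (N2 : S s ^ 2 <> 0) by now apply pow_nonzero.
    rewrite RtoC_div, <- E by easy. field.
    intro K. apply RtoC_inj in K. easy. }
  destruct (Hval t ltac:(lra) Hl) as [N E].
  split; [easy|]. split; [easy|].
  apply C_derive_real.
  destruct (wp_local w1 w2 (RtoC t) hw) as [d [eps [g [g1 [g2 [Hd [_ [_ Hw]]]]]]]].
  apply (derivable_C_ext_loc (fun s => RtoC (1 / S s ^ 2))).
  - assert (Hp : 0 < Rmin d t) by (apply Rmin_glb_lt; lra).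
    exists (mkposreal _ Hp). intros s Hs. change R in s.
    change (Rabs (s - t) < Rmin d t) in Hs.
    assert (M1 := Rmin_l d t). assert (M2 := Rmin_r d t).
    symmetry. apply Hval; [apply Rabs_def2 in Hs; lra|].
    destruct (Hw (s - t) ltac:(lra) (or_intror Hl)) as [A _].
    rewrite <- RtoC_plus in A. now replace (t + (s - t)) with s in A by ring.
  - apply derivable_C_RtoC. destruct (HS t) as [D _].
    auto_derive.
    + split; [eexists; eassumption|]. split; [|easy].
      now apply (pow_nonzero (S t) 2).
    + rewrite (is_derive_unique (fun u : R => S u) _ _ D). field. easy.
Qed.

(** [-(4/27) m^2] at time [r], by the addition theorem for [m]. *)
Definition lemniscate_T (S S1 : R -> R) (x y z : R) : R :=
  - (4 / 27) * lemniscate_add (S (rad x y z)) (S1 (rad x y z)) (start_value x y z) (start_slope x y z) ^ 2.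

Lemma start_first_integral (x y z : R) :
  admissible x y z -> start_slope x y z ^ 2 + 4 / 27 * start_value x y z ^ 4 = 1.
Proof.
  intro H. destruct (admissible_unit x y z H) as [Hr [_ [_ [_ [E2 [E4 _]]]]]].
  unfold start_value, start_slope. set (r := rad x y z) in *.
  rewrite Rpow_mult_distr, (vandermonde_sqr _ _ _ E2) by (rewrite <- E4; ring). field. lra.
Qed.

(** The denominator [K - wp] is nonzero because [K <= 0 < 1 / S^2]. *)
Lemma octT_formula_value (w1 w2 : C) (S S1 : R -> R) (x y z : R) :
  is_lattice_basis w1 w2 ->
  wp_satisfies_ode w1 w2 (RtoC (16 / 27)) (RtoC 0) ->
  lemniscatic S S1 -> S 0 = 0 -> admissible x y z ->
  ~ in_lattice w1 w2 (RtoC (rad x y z)) ->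
  RtoC (octK x y z) <> wp w1 w2 (RtoC (rad x y z)) /\
  octT_formula w1 w2 x y z = RtoC (lemniscate_T S S1 x y z).
Proof.
  intros hw hwp HS HS0 Hadm Hl.
  assert (Hr := proj1 (admissible_unit x y z Hadm)).
  destruct (wp_real_line w1 w2 S S1 _ hw hwp HS HS0 Hr Hl) as [N [E E']].
  assert (Hne : octK x y z - 1 / S (rad x y z) ^ 2 <> 0).
  { rewrite octK_start by easy. assert (A := pow2_ge_0 (start_value x y z)).
    assert (B : 0 < 1 / S (rad x y z) ^ 2).
    { apply Rdiv_lt_0_compat; [lra|]. now apply pow2_gt_0. }
    lra. }
  split.
  - rewrite E. intro K. apply RtoC_inj in K. lra.
  - rewrite (octT_formula_real _ _ _ _ _ _ _ E E' Hne). f_equal.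
    rewrite sqrt_octL, octK_start by easy. unfold lemniscate_T.
    destruct (HS (rad x y z)) as [_ [_ F]].
    apply weierstrass_addition; [easy|easy|now apply start_first_integral].
Qed.

Lemma lemniscate_T_continuous (S S1 : R -> R) (x y z : R) :
  lemniscatic S S1 -> 0 < rad x y z ->
  continuous (fun p : R * R * R => lemniscate_T S S1 (fst (fst p)) (snd (fst p)) (snd p))
    (x, y, z).
Proof.
  intros HS Hr.
  pose (X := fun p : R * R * R => fst (fst p)).
  pose (Y := fun p : R * R * R => snd (fst p)).
  pose (Z := fun p : R * R * R => snd p).
  assert (CX : continuous X (x, y, z)).
  { apply (continuous_comp fst fst); apply continuous_fst. }
  assert (CY : continuous Y (x, y, z)).
  { apply (continuous_comp fst snd); [apply continuous_fst|apply continuous_snd]. }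
  assert (CZ : continuous Z (x, y, z)) by apply continuous_snd.
  assert (Cm : forall f g : R * R * R -> R, continuous f (x, y, z) ->
     continuous g (x, y, z) -> continuous (fun p => f p * g p) (x, y, z)).
  { intros f g Hf Hg. now apply (continuous_mult (K := R_AbsRing) f g). }
  assert (Cp : forall f g : R * R * R -> R, continuous f (x, y, z) ->
     continuous g (x, y, z) -> continuous (fun p => f p + g p) (x, y, z)).
  { intros f g Hf Hg. now apply (continuous_plus (K := R_AbsRing) (V := R_NormedModule) f g). }
  assert (Cc : forall k : R, continuous (fun _ : R * R * R => k) (x, y, z)).
  { intro k. apply continuous_const. }
  assert (Cn : forall (f : R * R * R -> R) n, continuous f (x, y, z) ->
     continuous (fun p => f p ^ n) (x, y, z)).
  { intros f n Hf. induction n as [|n IH]; simpl; [apply Cc|now apply Cm]. }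
  assert (Ci : forall f : R * R * R -> R, continuous f (x, y, z) -> f (x, y, z) <> 0 ->
     continuous (fun p => / f p) (x, y, z)).
  { intros f Hf Hne. apply (continuous_comp f Rinv); [easy|now apply continuous_Rinv]. }
  pose (rr := fun p => rad (X p) (Y p) (Z p)).
  assert (CR : continuous rr (x, y, z)).
  { apply (continuous_comp (fun p => X p ^ 2 + Y p ^ 2 + Z p ^ 2) sqrt).
    - apply Cp; [apply Cp|]; now apply Cn.
    - apply continuous_sqrt. }
  assert (HN : rr (x, y, z) <> 0) by (unfold rr, X, Y, Z; simpl; lra).
  assert (CS : continuous (fun p => S (rr p)) (x, y, z)).
  { apply (continuous_comp rr S); [easy|].
    apply (ex_derive_continuous (K := R_AbsRing) (V := R_NormedModule)).
    eexists. exact (proj1 (HS _)). }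
  assert (CS1 : continuous (fun p => S1 (rr p)) (x, y, z)).
  { apply (continuous_comp rr S1); [easy|].
    apply (ex_derive_continuous (K := R_AbsRing) (V := R_NormedModule)).
    eexists. exact (proj1 (proj2 (HS _))). }
  assert (Cx : forall f : R * R * R -> R, continuous f (x, y, z) ->
     continuous (fun p => f p / rr p) (x, y, z)).
  { intros f Hf. apply Cm; [easy|]. now apply Ci. }
  assert (C0 : continuous (fun p => start_value (X p) (Y p) (Z p)) (x, y, z)).
  { apply (Cm (fun _ => 27 / 2)); [apply Cc|].
    apply (Cm (fun p => X p / rr p * (Y p / rr p)) (fun p => Z p / rr p));
      [apply (Cm (fun p => X p / rr p) (fun p => Y p / rr p))|]; now apply Cx. }
  assert (Cd : forall f g : R * R * R -> R, continuous f (x, y, z) ->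
     continuous g (x, y, z) -> continuous (fun p => f p - g p) (x, y, z)).
  { intros f g Hf Hg. now apply (continuous_minus (K := R_AbsRing) (V := R_NormedModule) f g). }
  assert (C1 : continuous (fun p => start_slope (X p) (Y p) (Z p)) (x, y, z)).
  { apply (Cm (fun _ => 27 / 2)); [apply Cc|]. unfold vandermonde.
    apply (Cm (fun p => ((X p / rr p) ^ 2 - (Y p / rr p) ^ 2)
                     * ((Y p / rr p) ^ 2 - (Z p / rr p) ^ 2))
              (fun p => (X p / rr p) ^ 2 - (Z p / rr p) ^ 2));
      [apply (Cm (fun p => (X p / rr p) ^ 2 - (Y p / rr p) ^ 2)
                 (fun p => (Y p / rr p) ^ 2 - (Z p / rr p) ^ 2))|];
      apply Cd; apply (Cn (fun p => _ / rr p)); now apply Cx. }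
  unfold lemniscate_T.
  apply (Cm (fun _ => - (4 / 27))); [apply Cc|].
  apply (Cn (fun p => lemniscate_add (S (rr p)) (S1 (rr p))
     (start_value (X p) (Y p) (Z p)) (start_slope (X p) (Y p) (Z p)))).
  unfold lemniscate_add.
  apply (Cm (fun p => S (rr p) * start_slope (X p) (Y p) (Z p) + S1 (rr p) * start_value (X p) (Y p) (Z p))
    (fun p => / (1 + 4 / 27 * (S (rr p) ^ 2 * start_value (X p) (Y p) (Z p) ^ 2)))).
  - apply (Cp (fun p => S (rr p) * start_slope (X p) (Y p) (Z p))
      (fun p => S1 (rr p) * start_value (X p) (Y p) (Z p))).
    + now apply (Cm (fun p => S (rr p)) (fun p => start_slope (X p) (Y p) (Z p))).
    + now apply (Cm (fun p => S1 (rr p)) (fun p => start_value (X p) (Y p) (Z p))).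
  - apply (Ci (fun p => 1 + 4 / 27 * (S (rr p) ^ 2 * start_value (X p) (Y p) (Z p) ^ 2))).
    + apply (Cp (fun _ => 1)); [apply Cc|].
      apply (Cm (fun _ => 4 / 27)); [apply Cc|].
      apply (Cm (fun p => S (rr p) ^ 2) (fun p => start_value (X p) (Y p) (Z p) ^ 2)).
      * now apply (Cn (fun p => S (rr p))).
      * now apply (Cn (fun p => start_value (X p) (Y p) (Z p))).
    + apply Rgt_not_eq, lemniscate_add_denominator.
Qed.

(** At a pole the formula agrees at the nearby admissible points with [lemniscate_T], which
    is continuous there. *)
Lemma octT_is_value (w1 w2 : C) (S S1 : R -> R) (x y z : R) :
  is_lattice_basis w1 w2 ->
  wp_satisfies_ode w1 w2 (RtoC (16 / 27)) (RtoC 0) ->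
  lemniscatic S S1 -> S 0 = 0 -> admissible x y z ->
  is_octT w1 w2 x y z (RtoC (lemniscate_T S S1 x y z)).
Proof.
  intros hw hwp HS HS0 Hadm. split.
  - intro Hl. destruct (octT_formula_value w1 w2 S S1 x y z hw hwp HS HS0 Hadm Hl).
    now split.
  - intros _.
    apply (filterlim_within_ext _ (fun p : R * R * R =>
      RtoC (lemniscate_T S S1 (fst (fst p)) (snd (fst p)) (snd p)))).
    + intros [[x' y'] z'] [Hadm' Hl']. symmetry.
      now apply (octT_formula_value w1 w2 S S1).
    + eapply filterlim_filter_le_1; [apply filter_le_within|].
      assert (Hc := lemniscate_T_continuous S S1 x y z HS
        (proj1 (admissible_unit x y z Hadm))).
      apply filterlim_locally. intro e.
      generalize (proj1 (filterlim_locally _ _) Hc e). apply filter_imp.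
      intros p Hp. split; [exact Hp|apply ball_center].
Qed.

(** The orbit of [(sqrt (2/3), sqrt (1/3), 0)], where [x y z] vanishes, starts with the
    right values. *)
Lemma lemniscate_sine_exists (phi : R * R * R -> R * R * R) :
  is_octahedral_superflow phi ->
  exists S S1, lemniscatic S S1 /\ S 0 = 0 /\ S1 0 = 1.
Proof.
  intro Hphi.
  assert (A : sqrt (2 / 3) ^ 2 = 2 / 3) by (apply pow2_sqrt; lra).
  assert (B : sqrt (1 / 3) ^ 2 = 1 / 3) by (apply pow2_sqrt; lra).
  destruct (unit_orbit phi (sqrt (2 / 3)) (sqrt (1 / 3)) 0 Hphi)
    as [x [y [z [Ho [_ [Ex [Ey Ez]]]]]]].
  - rewrite A, B. field.
  - replace (sqrt (2 / 3) ^ 4) with ((sqrt (2 / 3) ^ 2) ^ 2) by ring.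
    replace (sqrt (1 / 3) ^ 4) with ((sqrt (1 / 3) ^ 2) ^ 2) by ring.
    rewrite A, B. field.
  - exists (fun t => 27 / 2 * (x t * y t * z t)),
      (fun t => 27 / 2 * vandermonde (x t ^ 2) (y t ^ 2) (z t ^ 2)).
    split; [now apply orbit_lemniscatic|]. rewrite Ex, Ey, Ez. split; [ring|].
    unfold vandermonde. rewrite A, B. field.
Qed.

(** * The octahedral superflow *)

Theorem theorem9p3 (phi : R * R * R -> R * R * R)
  (hphi : is_octahedral_superflow phi)
  (w1 w2 : C) (hw : is_lattice_basis w1 w2)
  (hwp : wp_satisfies_ode w1 w2 (RtoC (16 / 27)) (RtoC 0))
  (x y z : R) (hxyz : admissible x y z) :
  let V := fst (fst (phi (x, y, z))) in
  0 <= octL x y z /\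
  exists T : R,
    is_octT w1 w2 x y z (RtoC T) /\
    0 <= 12 - 81 * T ^ 2 /\
    Cmod (octJ T) = 24 * sqrt 3 /\
    (exists c : C, is_cube_root (octJ T) c) /\
    forall c : C, is_cube_root (octJ T) c ->
      let q := (c / 18 + 2 / (3 * c) + 1 / 3)%C in
      Im q = 0 /\ 0 <= Re q /\
      V = sqrt (Re q) * sqrt (x ^ 2 + y ^ 2 + z ^ 2) /\
      0 < V.
Proof.
  intro V.
  destruct (lemniscate_sine_exists phi hphi) as [S [S1 [HS [HS0 HS1]]]].
  destruct (admissible_unit x y z hxyz)
    as [Hr [Ex [Ey [Ez [E2 [E4 [Hx2 [Px _]]]]]]]].
  set (r := rad x y z) in *.
  destruct (unit_orbit phi (x / r) (y / r) (z / r) hphi E2 E4)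
    as [X [Y [Z [Ho [HF [X0 [Y0 Z0]]]]]]].
  assert (Hm := orbit_lemniscatic X Y Z Ho).
  set (m := fun t => 27 / 2 * (X t * Y t * Z t)) in *.
  set (m1 := fun t => 27 / 2 * vandermonde (X t ^ 2) (Y t ^ 2) (Z t ^ 2)) in *.
  assert (ET : lemniscate_T S S1 x y z = - (4 / 27) * m r ^ 2).
  { unfold lemniscate_T, lemniscate_add. fold r.
    rewrite (lemniscatic_addition S S1 m m1 r HS HS0 HS1 Hm).
    unfold m, m1. rewrite X0, Y0, Z0. reflexivity. }
  rewrite <- X0 in Hx2, Px.
  destruct (orbit_largest_coordinate X Y Z r Ho Px Hx2 ltac:(lra)) as [PX LX].
  assert (HV : V = X r * r).
  { assert (H := HF r). unfold time_map in H.
    destruct (Req_EM_T r 0) as [K|_]; [lra|].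
    replace (scal r (x / r, y / r, z / r) : R * R * R) with (x, y, z) in H
      by (rewrite Ex, Ey, Ez at 1; reflexivity).
    apply (f_equal (fun p => fst (fst p))) in H.
    change (/ r * V = X r) in H. rewrite <- H. field. lra. }
  split; [rewrite octL_start by easy; apply pow2_ge_0|].
  exists (lemniscate_T S S1 x y z).
  split; [now apply octT_is_value|].
  destruct (Ho r) as [_ [_ [_ [F2 F4]]]].
  assert (F4' : (X r ^ 2) ^ 2 + (Y r ^ 2) ^ 2 + (Z r ^ 2) ^ 2 = 5 / 9)
    by (rewrite <- F4; ring).
  assert (HT : lemniscate_T S S1 x y z
    = - 27 * (X r ^ 2 * (X r ^ 2 - 1 / 3) * (X r ^ 2 - 2 / 3))).
  { rewrite ET. unfold m.
    rewrite (Rmult_assoc (X r ^ 2)), <- (other_roots_product _ _ _ F2 F4'). field. }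
  assert (HD : 0 <= 12 - 81 * lemniscate_T S S1 x y z ^ 2).
  { rewrite ET. destruct (Hm r) as [_ [_ I]].
    assert (A := pow2_ge_0 (m1 r)).
    replace ((- (4 / 27) * m r ^ 2) ^ 2) with (16 / 729 * m r ^ 4) by field. lra. }
  split; [easy|]. split; [now apply Cmod_octJ|].
  split; [now apply octJ_cube_root_exists|].
  intros c Hc q.
  assert (Eq : q = RtoC (X r ^ 2)) by (now apply (octJ_cube_root_value _ _ c HT)).
  rewrite Eq. split; [reflexivity|].
  change (Re (RtoC (X r ^ 2))) with (X r ^ 2).
  split; [apply pow2_ge_0|]. rewrite HV. split.
  - rewrite sqrt_pow2 by lra. reflexivity.
  - apply Rmult_lt_0_compat; easy.
Qed.
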